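(* Let $\alpha>-1$ and let $\varphi$ be a holomorphic self-map of $\mathbb{D}$. Then the adjoint of the composition operator $C_\varphi:A^2_\alpha(\mathbb{D})\to A^2_\alpha(\mathbb{D})$ is itself a composition operator (i.e. $C_\varphi^*=C_\psi$ for some holomorphic self-map $\psi$ of $\mathbb{D}$) if and only if $\varphi(z)=\delta z$ for some $\delta\in\mathbb{C}$ with $|\delta|\le1$.
   Context: $\mathbb{D}$ is the open unit disc and $dA$ the normalized area measure on $\mathbb{D}$. For $\alpha>-1$, the weighted Bergman space $A^2_\alpha(\mathbb{D})$ consists of holomorphic $f$ on $\mathbb{D}$ with $\|f\|^2=\int_{\mathbb{D}}|f(z)|^2(1-|z|^2)^\alpha\,dA(z)<\infty$; it is a reproducing kernel Hilbert space with kernel $\kappa_w(z)=(1-\overline{w}z)^{-(\alpha+2)}$ (up to the normalization of the measure). $C_\varphi f=f\circ\varphi$. *)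

(* Defs.v *)
(* Complex numbers are R[i] (real-closed
   complex), over an arbitrary R : realType; the analytic structure on C is
   the one of a numFieldType normed over itself, accessed via the alias (R[i])^o. *)
From HB Require Import structures.
From mathcomp Require Import all_boot all_order all_algebra.
From mathcomp Require Import all_classical all_reals all_analysis.
From mathcomp Require Import complex.
Set Implicit Arguments. Unset Strict Implicit. Unset Printing Implicit Defensive.
Import Order.TTheory GRing.Theory Num.Theory.
Import numFieldNormedType.Exports.
Local Open Scope ring_scope.
Local Open Scope complex_scope.
Local Open Scope classical_set_scope.

(* The complex plane, with its normed-module structure over itself. *)
Definition CC (R : realType) : Type := (R[i])^o.

(* Identification R x R = C, (x,y) |-> x + i y. *)
Definition toC (R : realType) (p : R * R) : CC R := p.1 +i* p.2.

(* The open unit disc, as a subset of C and of R x R. *)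
Definition in_disc (R : realType) (z : CC R) : Prop := `|z| < 1.
Definition discR (R : realType) : set (R * R) :=
  [set p | p.1 ^+ 2 + p.2 ^+ 2 < 1].
Arguments discR R : clear implicits.

(* Holomorphic on D: complex-differentiable at every point of D
   (derivative along the direction 1 with complex increments h -> 0). *)
Definition holo_disc (R : realType) (f : CC R -> CC R) : Prop :=
  forall z : CC R, in_disc z -> derivable f z 1.

(* Holomorphic self-map of D. *)
Definition holo_self_map (R : realType) (phi : CC R -> CC R) : Prop :=
  holo_disc phi /\ (forall z : CC R, in_disc z -> in_disc (phi z)).

(* Lebesgue (area) measure on R x R = C. *)
Definition area (R : realType) := (@lebesgue_measure R \x @lebesgue_measure R)%E.
Arguments area R : clear implicits.

(* Density of (1-|z|^2)^alpha dA(z), dA = dx dy / pi the normalized area measure. *)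
Definition bweight (R : realType) (alpha : R) (p : R * R) : R :=
  (1 - (p.1 ^+ 2 + p.2 ^+ 2)) `^ alpha / pi.

(* |w|^2 for w complex. *)
Definition sqmod (R : realType) (w : R[i]) : R := complex.Re w ^+ 2 + complex.Im w ^+ 2.

(* ||f||^2 = \int_D |f|^2 (1-|z|^2)^alpha dA  (in the extended reals). *)
Definition bnorm2 (R : realType) (alpha : R) (f : CC R -> CC R) : \bar R :=
  (\int[area R]_(p in discR R) (sqmod (f (toC p)) * bweight alpha p)%:E)%E.

(* Membership in the weighted Bergman space A^2_alpha(D). *)
Definition inA2 (R : realType) (alpha : R) (f : CC R -> CC R) : Prop :=
  holo_disc f /\ (bnorm2 alpha f < +oo)%E.

(* Inner product <f, g> = \int_D f conj(g) (1-|z|^2)^alpha dA. *)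
Definition binner (R : realType) (alpha : R) (f g : CC R -> CC R) : R[i] :=
  (\int[area R]_(p in discR R)
     (complex.Re (f (toC p) * (g (toC p))^*) * bweight alpha p))
  +i*
  (\int[area R]_(p in discR R)
     (complex.Im (f (toC p) * (g (toC p))^*) * bweight alpha p)).

(* The adjoint of C_phi on A^2_alpha is the composition operator C_psi:
   C_psi maps A^2_alpha into itself and <C_phi f, g> = <f, C_psi g>
   for all f, g in A^2_alpha. *)
Definition adjoint_is_comp (R : realType) (alpha : R)
    (phi psi : CC R -> CC R) : Prop :=
  (forall g, inA2 alpha g -> inA2 alpha (g \o psi)) /\
  (forall f g, inA2 alpha f -> inA2 alpha g ->
     binner alpha (f \o phi) g = binner alpha f (g \o psi)).

(* Main.v *)
Require Import Defs.
From HB Require Import structures.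
From mathcomp Require Import all_boot all_order all_algebra.
From mathcomp Require Import all_classical all_reals all_analysis.
From mathcomp Require Import measurable_realfun complex ring lra.
Import Order.TTheory GRing.Theory Num.Theory.
Import numFieldNormedType.Exports.
Set Implicit Arguments.
Unset Strict Implicit.
Unset Printing Implicit Defensive.
Local Open Scope ring_scope.
Local Open Scope complex_scope.
Local Open Scope classical_set_scope.

(* Goursat's quadrisection, applied to the homotopy contracting a circle to a
   point, gives Cauchy's formula and hence Taylor expansions of functions that are
   merely complex differentiable on the disc.  The measure is invariant under
   rotations, so the monomials are orthogonal on every disc |z| < rho, and
   <f, z^k> is the k-th Taylor coefficient of f times ||z^k||^2.

   If phi(z) = delta z, comparing coefficients on |z| < rho and letting rho tend
   to 1 gives <f(delta z), g> = <f, g(conj(delta) z)>, and likewise shows that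
   dilations are contractions.  Conversely, <1, z> = <1, psi> forces psi(0) = 0;
   then psi^k vanishes to order at least 2 at 0 for k >= 2, and
   <phi, z^k> = <z, psi^k> = 0 for every k <> 1, so phi is linear. *)

(** [holo_disc] grants only a derivative at each point, with no continuity of it, so Cauchy's
    theorem has to come from Goursat's argument. Applied to a form in the homotopy parameters
    [(s, t)], it only concerns rectangles. The parameter [s] stays positive because the form
    contains [ds / s]; the centre is reached afterwards by letting [s] tend to 0.

    A Taylor expansion converges uniformly only on smaller discs, and on the whole disc nothing but
    square integrability is known. Hence every identity is proved for [disco rho] with [rho < 1] and
    passed to the limit in the integrals. On such a disc convergence is recorded as an error at most
    [C * q ^+ n], so each limit in [n] becomes an elementary inequality and no infinite series is
    manipulated.

    The adjoint relation is tested on monomials only, so no reproducing kernel and no completeness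
    of the space enters. The assumption [-1 < alpha] enters through the finite mass of the weight,
    which puts bounded holomorphic functions into the space. Dilations are handled by comparing
    coefficients rather than by a change of variables, so [d = 0] and [normc d = 1] need no separate
    treatment. *)

(** * Integrals over intervals and rectangles; Goursat's theorem for real forms *)

Lemma integrable_EFinZ (d : measure_display) (T : measurableType d) (R : realType)
    (mu : {measure set T -> \bar R}) (D : set T) (k : R) (f : T -> R) :
  measurable D -> mu.-integrable D (EFin \o f) ->
  mu.-integrable D (EFin \o (fun x => k * f x)).
Proof.
move=> mD h; have -> : EFin \o (fun x => k * f x) = (fun x => k%:E * (EFin \o f) x)%E.
  by apply/funext => x /=; rewrite EFinM.
exact: integrableZl.
Qed.

Lemma integrable_EFinD (d : measure_display) (T : measurableType d) (R : realType)
    (mu : {measure set T -> \bar R}) (D : set T) (f g : T -> R) :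
  measurable D -> mu.-integrable D (EFin \o f) -> mu.-integrable D (EFin \o g) ->
  mu.-integrable D (EFin \o (fun x => f x + g x)).
Proof. by move=> mD hf hg; have := integrableD mD hf hg. Qed.

Lemma integrable_EFinB (d : measure_display) (T : measurableType d) (R : realType)
    (mu : {measure set T -> \bar R}) (D : set T) (f g : T -> R) :
  measurable D -> mu.-integrable D (EFin \o f) -> mu.-integrable D (EFin \o g) ->
  mu.-integrable D (EFin \o (fun x => f x - g x)).
Proof. by move=> mD hf hg; have := integrableB mD hf hg. Qed.

Lemma Rintegral_itv_split (R : realType) (f : R -> R) (a b c : R) :
  a <= b -> b <= c ->
  (@lebesgue_measure R).-integrable `[a, c] (EFin \o f) ->
  \int[@lebesgue_measure R]_(x in `[a, c]) f x =
  \int[@lebesgue_measure R]_(x in `[a, b]) f x +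
  \int[@lebesgue_measure R]_(x in `[b, c]) f x.
Proof.
move=> ab bc itf; rewrite -(@Rintegral_itv_obnd_cbnd _ b); last first.
  by apply: integrableS itf => //; apply: subset_itvr; rewrite bnd_simp.
by rewrite -(@Rintegral_itvB _ f (BLeft a) (BRight c) b)// addrC subrK.
Qed.

Lemma Rintegral_itv_cst (R : realType) (a b c : R) : a <= b ->
  \int[@lebesgue_measure R]_(x in `[a, b]) c = c * (b - a).
Proof.
move=> ab; rewrite Rintegral_cst//; congr (_ * _).
suff E : (@lebesgue_measure R) `[a, b] = (b - a)%:E by exact: (congr1 fine E).
rewrite lebesgue_measure_itv/= lte_fin; case: ltP => //= ba.
by apply/esym/eqP; rewrite eqe subr_eq0 eq_le ab ba.
Qed.

Lemma Rintegral_near_cst (R : realType) (f : R -> R) (a b c e : R) :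
  a <= b -> (@lebesgue_measure R).-integrable `[a, b] (EFin \o f) ->
  (forall x, a <= x <= b -> `|f x - c| <= e) ->
  `|\int[@lebesgue_measure R]_(x in `[a, b]) f x - c * (b - a)| <= e * (b - a).
Proof.
move=> ab itf fe; set mu := @lebesgue_measure R.
have itc r : mu.-integrable `[a, b] (EFin \o cst r).
  exact/continuous_compact_integrable/continuous_subspaceT/cst_continuous/segment_compact.
rewrite -!Rintegral_itv_cst// -RintegralB//; last exact: itc.
apply: le_trans (le_normr_Rintegral _ _) _ => //.
  by have := integrableB _ itf (itc c); apply.
apply: le_Rintegral => //.
- have := integrableB _ itf (itc c) => /(_ (measurable_itv _)) h.
  by have := integrable_norm h.
- exact: itc.
Qed.

(* The integral of [P dx + Q dy] along the boundary of the rectangle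
   [x, x + h] * [y, y + k]. *)
Definition rect_int (R : realType) (P Q : R -> R -> R) (x y h k : R) : R :=
  (\int[@lebesgue_measure R]_(u in `[x, x + h]) P u y -
   \int[@lebesgue_measure R]_(u in `[x, x + h]) P u (y + k)) +
  (\int[@lebesgue_measure R]_(v in `[y, y + k]) Q (x + h) v -
   \int[@lebesgue_measure R]_(v in `[y, y + k]) Q x v).

Definition rect_integrable (R : realType) (P Q : R -> R -> R) (x y h k : R) :=
  (forall v, y <= v <= y + k ->
     (@lebesgue_measure R).-integrable `[x, x + h] (EFin \o P^~ v)) /\
  (forall u, x <= u <= x + h ->
     (@lebesgue_measure R).-integrable `[y, y + k] (EFin \o Q u)).

Lemma rect_integrableS (R : realType) (P Q : R -> R -> R) (x y h k x' y' h' k' : R) :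
  x <= x' -> x' + h' <= x + h -> y <= y' -> y' + k' <= y + k ->
  rect_integrable P Q x y h k -> rect_integrable P Q x' y' h' k'.
Proof.
move=> xx hh yy kk [iP iQ]; split => [v|u] /andP[v1 v2].
- apply: integrableS (iP v _) => //; last by apply/andP; split; lra.
  by apply: subset_itv; rewrite bnd_simp.
- apply: integrableS (iQ u _) => //; last by apply/andP; split; lra.
  by apply: subset_itv; rewrite bnd_simp.
Qed.

(** Each edge interior to the large rectangle is traversed twice in opposite directions, so only the
    outer boundary survives in the sum. *)
Lemma rect_int_quarter (R : realType) (P Q : R -> R -> R) (x y h k : R) :
  0 <= h -> 0 <= k -> rect_integrable P Q x y h k ->
  rect_int P Q x y h k =
    rect_int P Q x y (h / 2) (k / 2) +
    rect_int P Q (x + h / 2) y (h / 2) (k / 2) +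
    rect_int P Q x (y + k / 2) (h / 2) (k / 2) +
    rect_int P Q (x + h / 2) (y + k / 2) (h / 2) (k / 2).
Proof.
move=> h0 k0 [iP iQ]; rewrite /rect_int.
have -> : x + h / 2 + h / 2 = x + h by lra.
have -> : y + k / 2 + k / 2 = y + k by lra.
have sP v : y <= v <= y + k -> _ :=
  fun vk => @Rintegral_itv_split R (P^~ v) x (x + h / 2) (x + h) _ _ (iP v vk).
have sQ u : x <= u <= x + h -> _ :=
  fun uh => @Rintegral_itv_split R (Q u) y (y + k / 2) (y + k) _ _ (iQ u uh).
rewrite (sP _ _ y) ?(sP _ _ (y + k)) ?(sQ _ _ x) ?(sQ _ _ (x + h)); try lra;
  by apply/andP; split; lra.
Qed.

(** The same [p2] appears in both affine approximations, so their boundary integral is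
    [p2 * h * k - p2 * k * h = 0]. Only the errors remain: at most [2 * e] on each pair of opposite
    sides. *)
Lemma rect_int_affine_bound (R : realType) (P Q : R -> R -> R)
    (x y h k x0 y0 P0 Q0 p1 p2 q2 e : R) :
  0 <= h -> 0 <= k -> rect_integrable P Q x y h k ->
  (forall u v, x <= u <= x + h -> y <= v <= y + k ->
    `|P u v - P0 - p1 * (u - x0) - p2 * (v - y0)| <= e /\
    `|Q u v - Q0 - p2 * (u - x0) - q2 * (v - y0)| <= e) ->
  `|rect_int P Q x y h k| <= 2 * e * (h + k).
Proof.
move=> h0 k0 [iP iQ] H; rewrite /rect_int.
have xx : x <= x <= x + h by apply/andP; split; lra.
have xh : x <= x + h <= x + h by apply/andP; split; lra.
have yy : y <= y <= y + k by apply/andP; split; lra.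
have yk : y <= y + k <= y + k by apply/andP; split; lra.
rewrite -!RintegralB//; [|exact: iQ|exact: iQ|exact: iP|exact: iP].
have iP' := integrableB _ (iP _ yy) (iP _ yk).
have iQ' := integrableB _ (iQ _ xh) (iQ _ xx).
have := @Rintegral_near_cst R (fun u => P u y - P u (y + k)) x (x + h) (- p2 * k) (2 * e).
rewrite lerDl => /(_ h0 (iP' (measurable_itv _))).
have := @Rintegral_near_cst R (fun v => Q (x + h) v - Q x v) y (y + k) (p2 * h) (2 * e).
rewrite lerDl => /(_ k0 (iQ' (measurable_itv _))).
set A := \int[_]_(_ in _) _; set B := \int[_]_(_ in _) _.
move=> HA HB.
have {}HA : `|A - p2 * h * (y + k - y)| <= 2 * e * (y + k - y).
  apply: HA => v yv; have [_ h1] := H _ _ xx yv; have [_ h2] := H _ _ xh yv.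
  move: h1 h2; rewrite !ler_norml => /andP[? ?] /andP[? ?].
  by apply/andP; split; lra.
have {}HB : `|B - - p2 * k * (x + h - x)| <= 2 * e * (x + h - x).
  apply: HB => v yv; have [h1 _] := H _ _ yv yy; have [h2 _] := H _ _ yv yk.
  move: h1 h2; rewrite !ler_norml => /andP[? ?] /andP[? ?].
  by apply/andP; split; lra.
move: HA HB; rewrite !ler_norml => /andP[? ?] /andP[? ?].
by apply/andP; split; nra.
Qed.

(** Sharing [p2] between the two expansions expresses that the [y]-derivative of [P] equals the
    [x]-derivative of [Q], that is, that [P dx + Q dy] is closed at the point. *)
Definition closed_form_at (R : realType) (P Q : R -> R -> R) (x0 y0 : R) :=
  exists p1 p2 q2, forall e, 0 < e -> exists2 d, 0 < d &
    forall x y, `|x - x0| <= d -> `|y - y0| <= d ->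
    `|P x y - P x0 y0 - p1 * (x - x0) - p2 * (y - y0)|
       <= e * (`|x - x0| + `|y - y0|) /\
    `|Q x y - Q x0 y0 - p2 * (x - x0) - q2 * (y - y0)|
       <= e * (`|x - x0| + `|y - y0|).

(* Goursat's quadrisection: differentiability of the form at every point is
   enough, no continuity of the partial derivatives is needed. *)
Lemma rect_int_eq0 (R : realType) (P Q : R -> R -> R) (x y h k : R) :
  0 <= h -> 0 <= k -> rect_integrable P Q x y h k ->
  (forall u v, x <= u <= x + h -> y <= v <= y + k -> closed_form_at P Q u v) ->
  rect_int P Q x y h k = 0.
Proof.
move=> h0 k0 iPQ cl; apply/eqP/negPn/negP => L0.
pose hn n := h / 2 ^+ n; pose kn n := k / 2 ^+ n.
pose L := `|rect_int P Q x y h k|.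
have Lgt0 : 0 < L by rewrite normr_gt0.
have p2 n : (0 : R) < 2 ^+ n by rewrite exprn_gt0.
have hnS n : hn n.+1 = hn n / 2 by rewrite /hn exprS invfM; ring.
have knS n : kn n.+1 = kn n / 2 by rewrite /kn exprS invfM; ring.
have hn0 n : 0 <= hn n by rewrite /hn divr_ge0// ltW.
have kn0 n : 0 <= kn n by rewrite /kn divr_ge0// ltW.
pose G n (p : R * R) := [/\ x <= p.1, p.1 + hn n <= x + h, y <= p.2,
   p.2 + kn n <= y + k & L / 4 ^+ n <= `|rect_int P Q p.1 p.2 (hn n) (kn n)|].
(* The hypothesis on the current rectangle stands under the existential, so that [choice] yields a
   total successor function. *)
have step (np : nat * (R * R)) : exists p', G np.1 np.2 ->
    [/\ G np.1.+1 p', np.2.1 <= p'.1, p'.1 + hn np.1.+1 <= np.2.1 + hn np.1,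
     np.2.2 <= p'.2 & p'.2 + kn np.1.+1 <= np.2.2 + kn np.1].
  case: np => n [u v] /=.
  have [Gn|] := pselect (G n (u, v)); last by exists (u, v).
  have [/= xu uh yv vk LG] := Gn.
  have iq := rect_integrableS xu uh yv vk iPQ.
  have E := rect_int_quarter (hn0 n) (kn0 n) iq.
  move: LG; rewrite E.
  set q1 := rect_int _ _ _ _ _ _; set q2 := rect_int _ _ _ _ _ _.
  set q3 := rect_int _ _ _ _ _ _; set q4 := rect_int _ _ _ _ _ _ => LG.
  have E4 : L / 4 ^+ n.+1 = L / 4 ^+ n / 4 by rewrite exprS invfM; ring.
  have : L / 4 ^+ n <= `|q1| + `|q2| + `|q3| + `|q4|.
    apply: le_trans LG _; apply: le_trans (ler_normD _ _) _; rewrite lerD2r.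
    by apply: le_trans (ler_normD _ _) _; rewrite lerD2r; exact: ler_normD.
  have hh := hn0 n; have kk := kn0 n; rewrite /G E4 hnS knS /=.
  have [l1|l1] := leP (L / 4 ^+ n / 4) `|q1|.
    by move=> _; exists (u, v) => _ /=; do !split => //; lra.
  have [l2|l2] := leP (L / 4 ^+ n / 4) `|q2|.
    by move=> _; exists (u + hn n / 2, v) => _ /=; do !split => //; lra.
  have [l3|l3] := leP (L / 4 ^+ n / 4) `|q3|.
    by move=> _; exists (u, v + kn n / 2) => _ /=; do !split => //; lra.
  have [l4|l4] := leP (L / 4 ^+ n / 4) `|q4|.
    by move=> _; exists (u + hn n / 2, v + kn n / 2) => _ /=; do !split => //; lra.
  by move=> ?; exfalso; lra.
have [F FP] := choice step.
pose p := fix p n : R * R := if n is m.+1 then F (m, p m) else (x, y).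
have Gp n : G n (p n).
  elim: n => [|n IH].
    by rewrite /G /= /hn /kn expr0 !divr1; split.
  by have [] := FP (n, p n) IH.
have p1n n m : (p n).1 <= (p (m + n)%N).1 /\
    (p (m + n)%N).1 + hn (m + n)%N <= (p n).1 + hn n.
  elim: m => [|m [I1 I2]]; first by rewrite add0n; split.
  have [_ a1 a2 _ _] := FP (m + n, p (m + n))%N (Gp _).
  by rewrite addSn; split; [exact: le_trans a1|exact: le_trans a2 _].
have p2n n m : (p n).2 <= (p (m + n)%N).2 /\
    (p (m + n)%N).2 + kn (m + n)%N <= (p n).2 + kn n.
  elim: m => [|m [I1 I2]]; first by rewrite add0n; split.
  have [_ _ _ a1 a2] := FP (m + n, p (m + n))%N (Gp _).
  by rewrite addSn; split; [exact: le_trans a1|exact: le_trans a2 _].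
(* Nested intervals have a common point: the supremum of the left ends lies below every right
   end. *)
have nested (a : nat -> R) (s : nat -> R) : (forall n, 0 <= s n) ->
    (forall n m, a n <= a (m + n)%N /\ a (m + n)%N + s (m + n)%N <= a n + s n) ->
    exists c, forall n, a n <= c <= a n + s n.
  move=> s0 H; have ub n m : a m <= a n + s n.
    have [nm|mn] := leqP n m.
      have [_] := H n (m - n)%N; rewrite subnK// => ?; have := s0 m; lra.
    have [? _] := H m (n - m)%N; move: (mn) => /ltnW mn'.
    by have := s0 n; have [+ _] := H m (n - m)%N; rewrite subnK//; lra.
  exists (sup (range a)) => n; apply/andP; split.
    apply: sup_upper_bound; last by exists n.
    by split; [exists (a 0); exists 0|exists (a 0 + s 0) => _ [m _ <-]; exact: ub].
  by apply: sup_le_ub; [exists (a 0); exists 0|move=> _ [m _ <-]; exact: ub].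
have [x0 x0P] := nested (fun n => (p n).1) hn hn0 p1n.
have [y0 y0P] := nested (fun n => (p n).2) kn kn0 p2n.
have hx0 : x <= x0 <= x + h by have := x0P 0; rewrite /= /hn expr0 divr1.
have hy0 : y <= y0 <= y + k by have := y0P 0; rewrite /= /kn expr0 divr1.
have [p1 [p2' [q2 H]]] := cl _ _ hx0 hy0.
(* The [+ 1] keeps [S] positive for a degenerate rectangle. Since the [n]-th rectangle has
   [hn n + kn n <= S / 2 ^+ n], the tolerance [L / (4 * S ^+ 2)] turns the affine bound into
   [L / 4 ^+ n / 2], half of what that rectangle must carry. *)
pose S := h + k + 1; have S0 : 0 < S by rewrite /S; lra.
have [|d d0 Hd] := H (L / (4 * S ^+ 2)); first by rewrite divr_gt0// mulr_gt0// exprn_gt0.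
have [n nd] : exists n, S / 2 ^+ n <= d.
  have := @cvg_geometric R S (2^-1).
  rewrite ger0_norm ?invr_ge0// => /(_ _)/cvgrPdist_le.
  have -> : (2^-1 < 1 :> R) by lra.
  move=> /(_ isT d d0) [N _ /(_ N (leqnn _))]; rewrite sub0r normrN /= => HN.
  by exists N; apply: le_trans HN; rewrite exprVn; exact: ler_norm.
have hS : hn n + kn n <= S / 2 ^+ n.
  by rewrite /hn /kn -mulrDl ler_pM2r ?invr_gt0// /S; lra.
have [xu uh yv vk LG] := Gp n.
have iq := rect_integrableS xu uh yv vk iPQ.
have /andP[x01 x02] := x0P n; have /andP[y01 y02] := y0P n.
have := hn0 n => hh; have := kn0 n => kk.
have := @rect_int_affine_bound R P Q _ _ _ _ x0 y0 (P x0 y0) (Q x0 y0) p1 p2' q2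
  (L / (4 * S ^+ 2) * (S / 2 ^+ n)) (hn0 n) (kn0 n) iq.
apply/not_implyP; split.
  move=> u v /andP[u1 u2] /andP[v1 v2].
  have ux : `|u - x0| <= hn n by rewrite ler_norml; apply/andP; split; lra.
  have vy : `|v - y0| <= kn n by rewrite ler_norml; apply/andP; split; lra.
  have [||h1 h2] := Hd u v; [lra|lra|].
  have e0 : 0 <= L / (4 * S ^+ 2) by rewrite ltW// divr_gt0// mulr_gt0// exprn_gt0.
  by split; [apply: le_trans h1 _|apply: le_trans h2 _]; rewrite ler_wpM2l//; lra.
apply/negP; rewrite -ltNge; apply: lt_le_trans LG.
have e0 : 0 < L / (4 * S ^+ 2) by rewrite divr_gt0// mulr_gt0// exprn_gt0.
have e1 : 0 < L / (4 * S ^+ 2) * (S / 2 ^+ n) by rewrite mulr_gt0// divr_gt0.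
apply: (@le_lt_trans _ _ (2 * (L / (4 * S ^+ 2) * (S / 2 ^+ n)) * (S / 2 ^+ n))).
  by rewrite ler_wpM2l// mulr_ge0// ltW.
rewrite (_ : _ * _ * _ = L / 4 ^+ n / 2).
  by rewrite ltr_pdivrMr// ltr_pMr ?ltr1n// divr_gt0// exprn_gt0.
have -> : (4 : R) ^+ n = 2 ^+ n * 2 ^+ n by rewrite -exprMn; congr (_ ^+ _); ring.
by have := p2 n; set t := 2 ^+ n => t0; field; rewrite !gt_eqF.
Qed.

(** * Complex differentiability through first-order expansions *)

Local Notation normc := Normc.normc.

(** The division-free form includes [y = x]. Over [R] it serves [cos] and [sin]; over [R[i]] its
    companion below serves holomorphic functions. *)
Lemma is_derive_normP (K : numFieldType) (f : K^o -> K^o) (x : K^o) (l : K) :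
  is_derive x 1 f l -> forall e : K, 0 < e -> exists2 d : K, 0 < d &
    forall y : K, `|y - x| <= d -> `|f y - f x - l * (y - x)| <= e * `|y - x|.
Proof.
move=> [df <-] e e0; have /cvgrPdist_le H : _ --> 'D_1 f x := df.
move: (H _ e0) => [d d0 Hd]; exists (d / 2); first by rewrite divr_gt0.
move=> y; have [->|yx] := eqVneq y x; first by rewrite !subrr mulr0 subr0 normr0 mulr0.
move=> yd; have := Hd (y - x); rewrite /= sub0r normrN subr_eq0 => /(_ _ yx).
have h2 : d / 2 < d by rewrite ltr_pdivrMr// ltr_pMr// ltr1n.
move=> /(_ (le_lt_trans yd h2)).
rewrite /shift /= [_ *: 1]mulr1 subrK => h.
have n0 : 0 < `|y - x| by rewrite normr_gt0 subr_eq0.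
rewrite -ler_pdivrMr// -normfV -normrM; move: h; rewrite -normrN; congr (_ <= _).
congr (`|_|); rewrite opprB [in RHS]mulrBl mulfK ?subr_eq0//; congr (_ - _).
by rewrite /= mulrC.
Qed.

Lemma derivable_normP (K : numFieldType) (f : K^o -> K^o) (x : K^o) :
  derivable f x 1 <-> exists l : K, forall e : K, 0 < e -> exists2 d : K, 0 < d &
    forall y : K, `|y - x| <= d -> `|f y - f x - l * (y - x)| <= e * `|y - x|.
Proof.
split=> [/derivableP df|[l H]]; first by exists ('D_1 f x); exact: is_derive_normP.
apply/cvg_ex; exists l; apply/cvgrPdist_le => e e0.
have [d d0 Hd] := H _ e0; exists d => // h /=; rewrite sub0r normrN => hd h0.
have := Hd (h + x); rewrite addrK => /(_ (ltW hd)).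
rewrite /shift /= [_ *: 1]mulr1 => hh.
have n0 : 0 < `|h| by rewrite normr_gt0.
move: hh; rewrite -ler_pdivrMr// -normfV -normrM -normrN; congr (_ <= _).
by congr (`|_|); rewrite [in LHS]mulrBl mulfK// opprB; congr (_ - _); rewrite mulrC.
Qed.

Lemma normcE (R : realType) (z : R[i]) : `|z| = (normc z)%:C.
Proof. by []. Qed.

Lemma normc_ge0 (R : realType) (z : R[i]) : 0 <= normc z.
Proof. by rewrite -ler0c -normcE. Qed.

Lemma ler_normcD (R : realType) (x y : R[i]) : normc (x + y) <= normc x + normc y.
Proof. exact: le_normcD. Qed.

Lemma normcNE (R : realType) (x : R[i]) : normc (- x) = normc x.
Proof. exact: normcN. Qed.

Lemma normcBC (R : realType) (x y : R[i]) : normc (x - y) = normc (y - x).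
Proof. by rewrite -normcNE opprB. Qed.

Lemma normc_real (R : realType) (x : R) : normc x%:C = `|x|.
Proof. by rewrite /= expr0n addr0 sqrtr_sqr. Qed.

Lemma normc_Re (R : realType) (z : R[i]) : `|complex.Re z| <= normc z.
Proof. by case: z => a b /=; rewrite -sqrtr_sqr ler_wsqrtr// lerDl sqr_ge0. Qed.

Lemma normc_Im (R : realType) (z : R[i]) : `|complex.Im z| <= normc z.
Proof. by case: z => a b /=; rewrite -sqrtr_sqr ler_wsqrtr// lerDr sqr_ge0. Qed.

Lemma normc_le_ReIm (R : realType) (a b : R) : normc (a +i* b) <= `|a| + `|b|.
Proof.
have -> : a +i* b = a%:C + 'i * b%:C by simpc.
apply: le_trans (ler_normcD _ _) _; rewrite Normc.normcM !normc_real.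
by rewrite /= expr0n expr1n add0r sqrtr1 mul1r.
Qed.

Lemma normc_X (R : realType) (z : R[i]) n : normc (z ^+ n) = normc z ^+ n.
Proof. by apply: (@complexI R); rewrite -normcE normrX normcE -rmorphXn. Qed.

Lemma in_discP (R : realType) (z : R[i]) : in_disc (z : CC R) <-> normc z < 1.
Proof. by rewrite /in_disc -ltcR. Qed.

(* First-order expansion [F p = F0 + L p + o(N p)], where [N] measures the
   distance to the base point. *)
Definition expands (R : realType) (T : Type) (N : T -> R) (F : T -> R[i])
    (F0 : R[i]) (L : T -> R[i]) :=
  (exists2 M, 0 < M & forall p, normc (L p) <= M * N p) /\
  (forall e, 0 < e -> exists2 d, 0 < d &
     forall p, N p <= d -> normc (F p - F0 - L p) <= e * N p).

(** The bound on [L] takes the place of linearity, which has no meaning on a bare type [T]. The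
    resulting Lipschitz estimate at the base point is what products and compositions rely on. *)
Lemma expands_lip (R : realType) (T : Type) (N : T -> R) F F0 L :
  (forall p, 0 <= N p) -> expands N F F0 L ->
  exists M d : R, [/\ 0 < M, 0 < d & forall p, N p <= d -> normc (F p - F0) <= M * N p].
Proof.
move=> N0 [[M M0 LM] H]; have [d d0 Hd] := H 1 ltr01.
exists (1 + M), d; split => //; first by rewrite addr_gt0.
move=> p pd; rewrite -(subrK (L p) (F p - F0)).
apply: le_trans (ler_normcD _ _) _; rewrite mulrDl; apply: lerD => //.
exact: Hd.
Qed.

Lemma expands_cst (R : realType) (T : Type) (N : T -> R) (c : R[i]) :
  (forall p, 0 <= N p) -> expands N (fun=> c) c (fun=> 0).
Proof.
move=> N0; split.
  by exists 1 => // p; rewrite Normc.normc0 mul1r.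
by move=> e e0; exists 1 => // p _; rewrite subrr subr0 Normc.normc0 mulr_ge0// ltW.
Qed.

Lemma expandsD (R : realType) (T : Type) (N : T -> R) F F0 LF G G0 LG :
  expands N F F0 LF -> expands N G G0 LG ->
  expands N (fun p => F p + G p) (F0 + G0) (fun p => LF p + LG p).
Proof.
move=> [[M M0 LM] H] [[M' M'0 LM'] H']; split.
  exists (M + M') => [|p]; first exact: addr_gt0.
  by apply: le_trans (ler_normcD _ _) _; rewrite mulrDl lerD.
move=> e e0; have e20 : 0 < e / 2 by rewrite divr_gt0.
have [d d0 Hd] := H _ e20; have [d' d'0 Hd'] := H' _ e20.
exists (Num.min d d'); first by rewrite lt_min d0.
move=> p; rewrite le_min => /andP[pd pd'].
rewrite (_ : _ - _ - _ = (F p - F0 - LF p) + (G p - G0 - LG p)); last by ring.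
apply: le_trans (ler_normcD _ _) _; rewrite (splitr e) mulrDl lerD//.
  exact: Hd.
exact: Hd'.
Qed.

Lemma expandsM (R : realType) (T : Type) (N : T -> R) F F0 LF G G0 LG :
  (forall p, 0 <= N p) ->
  expands N F F0 LF -> expands N G G0 LG ->
  expands N (fun p => F p * G p) (F0 * G0) (fun p => LF p * G0 + F0 * LG p).
Proof.
move=> N0 HF HG; have [A [d1 [A0 d10 HA]]] := expands_lip N0 HF.
have [B [d2 [B0 d20 HB]]] := expands_lip N0 HG.
move: HF HG => [[M M0 LM] H] [[M' M'0 LM'] H']; split.
  exists (M * normc G0 + normc F0 * M' + 1) => [|p].
    by rewrite ltr_wpDl// addr_ge0// mulr_ge0 ?normc_ge0// ltW.
  apply: le_trans (ler_normcD _ _) _; rewrite !Normc.normcM !mulrDl mul1r.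
  rewrite -[leLHS]addr0; apply: lerD => //; apply: lerD.
    by rewrite mulrAC ler_wpM2r ?normc_ge0.
  by rewrite -mulrA ler_wpM2l ?normc_ge0.
move=> e e0.
pose g := normc G0 + 1; pose f := normc F0 + 1.
have g0 : 0 < g by rewrite ltr_wpDl ?normc_ge0.
have f0 : 0 < f by rewrite ltr_wpDl ?normc_ge0.
have [d3 d30 H3] := H (e / 3 / g) (divr_gt0 (divr_gt0 e0 (ltr0n _ 3)) g0).
have [d4 d40 H4] := H' (e / 3 / f) (divr_gt0 (divr_gt0 e0 (ltr0n _ 3)) f0).
(* One third of [e] goes to each remainder multiplied by the other base value, and one third to the
   product of the increments; that product is at most [A * B * N p ^+ 2], whence the last term of
   the minimum. *)
exists (Num.min (Num.min d1 d2) (Num.min (Num.min d3 d4) (e / 3 / (A * B)))).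
  by rewrite !lt_min d10 d20 d30 d40 !divr_gt0// mulr_gt0.
move=> p; rewrite !le_min => /andP[/andP[p1 p2] /andP[/andP[p3 p4] p5]].
rewrite (_ : _ - _ - _ = (F p - F0 - LF p) * G0 + (G p - G0 - LG p) * F0
   + (F p - F0) * (G p - G0)); last by ring.
have {}H3 := H3 _ p3; have {}H4 := H4 _ p4.
have {}HA := HA _ p1; have {}HB := HB _ p2.
apply: le_trans (ler_normcD _ _) _; rewrite (_ : e = e / 3 + e / 3 + e / 3); last by field.
rewrite 2![in leRHS]mulrDl; apply: lerD; last first.
  rewrite Normc.normcM; apply: (@le_trans _ _ ((A * N p) * (B * N p))).
    by apply: ler_pM => //; exact: normc_ge0.
  rewrite (_ : _ * _ = (N p * (A * B)) * N p); last by ring.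
  by rewrite ler_wpM2r// -ler_pdivlMr// mulr_gt0.
apply: le_trans (ler_normcD _ _) _; rewrite !Normc.normcM; apply: lerD.
  apply: (@le_trans _ _ ((e / 3 / g * N p) * g)).
    by apply: ler_pM; rewrite ?normc_ge0// /g lerDl.
  by rewrite mulrAC divfK// gt_eqF.
apply: (@le_trans _ _ ((e / 3 / f * N p) * f)).
  by apply: ler_pM; rewrite ?normc_ge0// /f lerDl.
by rewrite mulrAC divfK// gt_eqF.
Qed.

Definition cderiv (R : realType) (f : R[i] -> R[i]) (z l : R[i]) :=
  expands (fun p => normc (p - z)) f (f z) (fun p => l * (p - z)).

(** The inner map may live on any [T]: this differentiates a holomorphic function along one or two
    real parameters as well as along a complex one. *)
Lemma expands_comp (R : realType) (T : Type) (N : T -> R) (f : R[i] -> R[i]) z l F LF :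
  (forall p, 0 <= N p) -> cderiv f z l -> expands N F z LF ->
  expands N (fun p => f (F p)) (f z) (fun p => l * LF p).
Proof.
move=> N0 [_ Hf] HF; have [A [d1 [A0 d10 HA]]] := expands_lip N0 HF.
move: HF => [[M M0 LM] H]; split.
  exists (normc l * M + 1) => [|p]; first by rewrite ltr_wpDl// mulr_ge0 ?normc_ge0// ltW.
  rewrite Normc.normcM mulrDl mul1r -[leLHS]addr0; apply: lerD => //.
  by rewrite -mulrA ler_wpM2l ?normc_ge0.
move=> e e0; pose m := normc l + 1.
have m0 : 0 < m by rewrite ltr_wpDl ?normc_ge0.
have [d2 d20 H2] := Hf (e / 2 / A) (divr_gt0 (divr_gt0 e0 (ltr0n _ 2)) A0).
have [d3 d30 H3] := H (e / 2 / m) (divr_gt0 (divr_gt0 e0 (ltr0n _ 2)) m0).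
exists (Num.min (Num.min d1 d3) (d2 / A)); first by rewrite !lt_min d10 d30 divr_gt0.
move=> p; rewrite !le_min => /andP[/andP[p1 p3] p2].
have {}HA := HA _ p1; have {}H3 := H3 _ p3.
have {}H2 : normc (f (F p) - f z - l * (F p - z)) <= e / 2 * N p.
  apply: le_trans (H2 _ _) _.
    by apply: le_trans HA _; rewrite mulrC -ler_pdivlMr.
  apply: (@le_trans _ _ (e / 2 / A * (A * N p))).
    by rewrite ler_wpM2l// ltW// !divr_gt0.
  by rewrite mulrA divfK// gt_eqF.
rewrite (_ : _ - _ - _ = (f (F p) - f z - l * (F p - z)) + l * (F p - z - LF p)); last by ring.
apply: le_trans (ler_normcD _ _) _; rewrite [in leRHS](splitr e) mulrDl; apply: lerD => //.
rewrite Normc.normcM; apply: (@le_trans _ _ (m * (e / 2 / m * N p))).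
  by apply: ler_pM; rewrite ?normc_ge0// /m lerDl.
by rewrite mulrC mulrAC divfK// gt_eqF.
Qed.

(** The norm of [CC R] takes its values in [R[i]], and so do the tolerances; being positive they are
    real, and they are carried back and forth through [complex.Re]. *)
Lemma derivable_cderivP (R : realType) (f : CC R -> CC R) (z : CC R) :
  derivable f z 1 <-> exists l, cderiv f z l.
Proof.
split.
  move=> /derivable_normP[l H]; exists l; split.
    exists (normc (l : R[i]) + 1) => [|p]; first by rewrite ltr_wpDl ?normc_ge0.
    by rewrite Normc.normcM ler_wpM2r ?normc_ge0// lerDl.
  move=> e e0; have [|d d0 Hd] := H e%:C; first by rewrite ltcR.
  have dE : d = (complex.Re d)%:C by rewrite RRe_real// gtr0_real.
  exists (complex.Re d); first by rewrite -ltcR -dE.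
  move=> p; rewrite -lecR -dE => /Hd.
  by rewrite !normcE -rmorphM lecR.
move=> [l [_ H]]; apply/derivable_normP; exists l => e e0.
have eE : e = (complex.Re e)%:C by rewrite RRe_real// gtr0_real.
have [|d d0 Hd] := H (complex.Re e); first by rewrite -ltcR -eE.
exists d%:C; first by rewrite ltcR.
by move=> p; rewrite normcE lecR => /Hd; rewrite -lecR rmorphM/= -eE.
Qed.

Lemma eq_expands (R : realType) (T : Type) (N : T -> R) F G F0 L L' :
  F =1 G -> L =1 L' -> expands N F F0 L -> expands N G F0 L'.
Proof. by move=> /funext -> /funext ->. Qed.

Lemma cderiv_id (R : realType) (z : R[i]) : cderiv id z 1.
Proof.
split; first by exists 1 => // p; rewrite mul1r mul1r.
move=> e e0; exists 1 => // p _.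
by rewrite mul1r subrr Normc.normc0 mulr_ge0 ?normc_ge0// ltW.
Qed.

Lemma cderiv_cst (R : realType) (c z : R[i]) : cderiv (fun=> c) z 0.
Proof.
apply: eq_expands (expands_cst _ (fun=> normc_ge0 _)) => // p.
by rewrite mul0r.
Qed.

Lemma cderivD (R : realType) (f g : R[i] -> R[i]) z l m :
  cderiv f z l -> cderiv g z m -> cderiv (fun z => f z + g z) z (l + m).
Proof.
by move=> Hf Hg; apply: eq_expands (expandsD Hf Hg) => // p; rewrite mulrDl.
Qed.

Lemma cderivM (R : realType) (f g : R[i] -> R[i]) z l m :
  cderiv f z l -> cderiv g z m ->
  cderiv (fun z => f z * g z) z (l * g z + f z * m).
Proof.
move=> Hf Hg; apply: eq_expands (expandsM (fun=> normc_ge0 _) Hf Hg) => // p.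
ring.
Qed.

Lemma cderiv_comp (R : realType) (f g : R[i] -> R[i]) z l m :
  cderiv f (g z) l -> cderiv g z m -> cderiv (fun z => f (g z)) z (l * m).
Proof.
move=> Hf Hg; apply: eq_expands (expands_comp (fun=> normc_ge0 _) Hf Hg) => // p.
exact: mulrA.
Qed.

Lemma cderivV (R : realType) (z : R[i]) : z != 0 -> exists l, cderiv (fun z => z^-1) z l.
Proof.
move=> z0; apply/(@derivable_cderivP R (fun z : CC R => (z : R[i])^-1)).
exact: (derivableV z0 (@derivable_id _ _ (z : CC R) 1)).
Qed.

Lemma cderivX (R : realType) n (z : R[i]) : exists l, cderiv (fun z => z ^+ n) z l.
Proof.
elim: n => [|n [l IH]]; first by exists 0; exact: cderiv_cst.
eexists; rewrite /cderiv exprS.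
by apply: eq_expands (cderivM (cderiv_id z) IH) => // p; rewrite exprS.
Qed.

Lemma holo_discP (R : realType) (f : CC R -> CC R) :
  holo_disc f <-> forall z : R[i], normc z < 1 -> exists l, cderiv f z l.
Proof.
split=> H z; first by move=> /in_discP /H /derivable_cderivP.
by move=> /in_discP /H /derivable_cderivP.
Qed.

(** * The unit circle, and complex forms in two real parameters *)

Definition cis (R : realType) (t : R) : R[i] := cos t +i* sin t.

Lemma normc_cis (R : realType) (t : R) : normc (cis t) = 1.
Proof. by rewrite /= cos2Dsin2 sqrtr1. Qed.

Lemma cis_neq0 (R : realType) (t : R) : cis t != 0.
Proof.
apply/eqP => c0; have := normc_cis t; rewrite c0 Normc.normc0 => /eqP.
by rewrite eq_sym oner_eq0.
Qed.

Lemma cis2pi (R : realType) : cis (pi *+ 2) = cis (0 : R).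
Proof. by rewrite /cis cos2pi sin2pi cos0 sin0. Qed.

Lemma cis_expands (R : realType) (t : R) :
  expands (fun u => `|u - t|) (@cis R) (cis t) (fun u => 'i * cis t * (u - t)%:C).
Proof.
split.
  exists 1 => // p; rewrite !Normc.normcM normc_cis normc_real.
  by rewrite /= expr0n expr1n add0r sqrtr1 !mul1r.
move=> e e0; have e20 : 0 < e / 2 by rewrite divr_gt0.
have [d d0 Hd] := is_derive_normP (is_derive_cos t) e20.
have [d' d'0 Hd'] := is_derive_normP (is_derive_sin t) e20.
exists (Num.min d d'); first by rewrite lt_min d0.
move=> p; rewrite le_min => /andP[pd pd'].
rewrite (_ : _ - _ - _ = (cos p - cos t - - sin t * (p - t)) +i*
   (sin p - sin t - cos t * (p - t))); last first.
  by rewrite /cis; simpc; congr (_ +i* _); ring.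
apply: le_trans (normc_le_ReIm _ _) _; rewrite (splitr e) mulrDl.
by apply: lerD; [exact: Hd|exact: Hd'].
Qed.

Lemma expands_fst (R : realType) (x y : R) :
  expands (fun p : R * R => `|p.1 - x| + `|p.2 - y|) (fun p => p.1%:C) x%:C
    (fun p => (p.1 - x)%:C).
Proof.
split; first by exists 1 => // p; rewrite normc_real mul1r lerDl.
move=> e e0; exists 1 => // p _.
rewrite -rmorphB subrr Normc.normc0 mulr_ge0 ?addr_ge0//; exact: ltW.
Qed.

Lemma expands_snd (R : realType) (F L : R -> R[i]) (x y : R) :
  expands (fun u => `|u - y|) F (F y) L ->
  expands (fun p : R * R => `|p.1 - x| + `|p.2 - y|) (fun p => F p.2) (F y)
    (fun p => L p.2).
Proof.
move=> [[M M0 LM] H]; split.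
  exists M => // p; apply: le_trans (LM _) _.
  by rewrite ler_wpM2l ?lerDr// ltW.
move=> e e0; have [d d0 Hd] := H _ e0; exists d => // p pd.
apply: le_trans (Hd _ _) _.
  by apply: le_trans pd; rewrite lerDr.
by rewrite ler_wpM2l ?lerDr// ltW.
Qed.

(** [B] is the common cross derivative of a complex form. Taking real and imaginary parts of the
    coefficients splits the form into two closed real ones, to which Goursat's theorem applies
    separately. *)
Lemma closed_form_at_expands (R : realType) (P Q : R * R -> R[i]) (x y : R) LP LQ A B D :
  expands (fun p : R * R => `|p.1 - x| + `|p.2 - y|) P (P (x, y)) LP ->
  expands (fun p : R * R => `|p.1 - x| + `|p.2 - y|) Q (Q (x, y)) LQ ->
  (forall p, LP p = A * (p.1 - x)%:C + B * (p.2 - y)%:C) ->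
  (forall p, LQ p = B * (p.1 - x)%:C + D * (p.2 - y)%:C) ->
  closed_form_at (fun u v => complex.Re (P (u, v))) (fun u v => complex.Re (Q (u, v))) x y /\
  closed_form_at (fun u v => complex.Im (P (u, v))) (fun u v => complex.Im (Q (u, v))) x y.
Proof.
move=> [_ HP] [_ HQ] EP EQ.
have key e : 0 < e -> exists2 d, 0 < d & forall u v, `|u - x| <= d -> `|v - y| <= d ->
    normc (P (u, v) - P (x, y) - (A * (u - x)%:C + B * (v - y)%:C))
      <= e * (`|u - x| + `|v - y|) /\
    normc (Q (u, v) - Q (x, y) - (B * (u - x)%:C + D * (v - y)%:C))
      <= e * (`|u - x| + `|v - y|).
  move=> e0; have [d d0 Hd] := HP _ e0; have [d' d'0 Hd'] := HQ _ e0.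
  exists (Num.min d d' / 2); first by rewrite divr_gt0// lt_min d0.
  move=> u v ud vd.
  have : `|u - x| + `|v - y| <= Num.min d d' by lra.
  rewrite le_min => /andP[h1 h2].
  by have := Hd (u, v) h1; have := Hd' (u, v) h2; rewrite EP EQ /=; split.
have affRe (a b c d : R[i]) s t : complex.Re (a - b - (c * s%:C + d * t%:C)) =
    complex.Re a - complex.Re b - complex.Re c * s - complex.Re d * t.
  by case: a b c d => [? ?] [? ?] [? ?] [? ?] /=; ring.
have affIm (a b c d : R[i]) s t : complex.Im (a - b - (c * s%:C + d * t%:C)) =
    complex.Im a - complex.Im b - complex.Im c * s - complex.Im d * t.
  by case: a b c d => [? ?] [? ?] [? ?] [? ?] /=; ring.
split.
  exists (complex.Re A), (complex.Re B), (complex.Re D) => e e0.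
  have [d d0 Hd] := key e e0; exists d => // u v ud vd; have [h1 h2] := Hd u v ud vd.
  by rewrite -!affRe; split; [apply: le_trans h1|apply: le_trans h2]; exact: normc_Re.
exists (complex.Im A), (complex.Im B), (complex.Im D) => e e0.
have [d d0 Hd] := key e e0; exists d => // u v ud vd; have [h1 h2] := Hd u v ud vd.
by rewrite -!affIm; split; [apply: le_trans h1|apply: le_trans h2]; exact: normc_Im.
Qed.

Lemma lipschitz_at_continuous (R : realType) (f : R -> R) (a b : R) :
  (forall x, a <= x <= b -> exists M d : R, [/\ 0 < M, 0 < d &
     forall u, `|u - x| <= d -> `|f u - f x| <= M * `|u - x|]) ->
  {within `[a, b], continuous f}.
Proof.
move=> H; apply: continuous_in_subspaceT => x.
rewrite inE/= in_itv/= => /H[M [d [M0 d0 Hd]]].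
apply/cvgrPdist_le => e e0; apply/nbhs_ballP.
exists (Num.min d (e / M)) => /=; first by rewrite lt_min d0 divr_gt0.
move=> u; rewrite /ball /= lt_min distrC => /andP[/ltW ud /ltW uM].
by rewrite distrC; apply: le_trans (Hd u ud) _; rewrite mulrC -ler_pdivlMr.
Qed.

Lemma lipschitz_at_integrable (R : realType) (f : R -> R) (a b : R) :
  (forall x, a <= x <= b -> exists M d : R, [/\ 0 < M, 0 < d &
     forall u, `|u - x| <= d -> `|f u - f x| <= M * `|u - x|]) ->
  (@lebesgue_measure R).-integrable `[a, b] (EFin \o f).
Proof.
move=> /lipschitz_at_continuous; apply: continuous_compact_integrable.
exact: segment_compact.
Qed.

(** Differentiability at a point gives a Lipschitz bound there, hence continuity along every
    horizontal and vertical segment. *)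
Lemma closed_form_rect_integrable (R : realType) (P Q : R -> R -> R) (x y h k : R) :
  (forall u v, x <= u <= x + h -> y <= v <= y + k -> closed_form_at P Q u v) ->
  rect_integrable P Q x y h k.
Proof.
move=> H; split=> [v hv|u hu]; apply: lipschitz_at_integrable.
  move=> u hu; have [p1 [p2 [q2 /(_ 1 ltr01)[d d0 Hd]]]] := H u v hu hv.
  exists (1 + `|p1|), d; split => //.
  move=> u' u'd; have := Hd u' v u'd; rewrite subrr normr0 => /(_ (ltW d0))[+ _].
  rewrite mulr0 subr0 addr0 => h1; rewrite -(subrK (p1 * (u' - u)) (P u' v - P u v)).
  by apply: le_trans (ler_normD _ _) _; rewrite mulrDl normrM lerD2r.
move=> v hv; have [p1 [p2 [q2 /(_ 1 ltr01)[d d0 Hd]]]] := H u v hu hv.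
exists (1 + `|q2|), d; split => //.
move=> v' v'd; have := Hd u v'; rewrite subrr normr0 => /(_ (ltW d0) v'd)[_ +].
rewrite mulr0 subr0 add0r => h1; rewrite -(subrK (q2 * (v' - v)) (Q u v' - Q u v)).
by apply: le_trans (ler_normD _ _) _; rewrite mulrDl normrM lerD2r.
Qed.

(** * Integrals of complex functions over one period *)

(** [L] is left unspecified: this is a condition stable under algebraic operations and composition
    with holomorphic functions, from which continuity and integrability follow. *)
Definition cdiff (R : realType) (F : R -> R[i]) :=
  forall t, exists L, expands (fun u => `|u - t|) F (F t) L.

Lemma cdiff_cst (R : realType) (c : R[i]) : cdiff (fun _ : R => c).
Proof. by move=> t; eexists; apply: expands_cst. Qed.

Lemma cdiffD (R : realType) (F G : R -> R[i]) :
  cdiff F -> cdiff G -> cdiff (fun t => F t + G t).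
Proof. by move=> HF HG t; have [L h] := HF t; have [M g] := HG t; eexists; apply: expandsD h g. Qed.

Lemma cdiffM (R : realType) (F G : R -> R[i]) :
  cdiff F -> cdiff G -> cdiff (fun t => F t * G t).
Proof.
move=> HF HG t; have [L h] := HF t; have [M g] := HG t.
by eexists; apply: expandsM h g.
Qed.

Lemma cdiff_comp (R : realType) (f : R[i] -> R[i]) (F : R -> R[i]) :
  (forall t, exists l, cderiv f (F t) l) -> cdiff F -> cdiff (fun t => f (F t)).
Proof.
move=> Hf HF t; have [L h] := HF t; have [l g] := Hf t.
by eexists; apply: (expands_comp _ g h).
Qed.

Lemma cdiff_cis (R : realType) : cdiff (@cis R).
Proof. by move=> t; eexists; exact: cis_expands. Qed.

Lemma cdiff_integrable (R : realType) (F : R -> R[i]) (a b : R) : cdiff F ->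
  (@lebesgue_measure R).-integrable `[a, b] (EFin \o (fun t => complex.Re (F t))) /\
  (@lebesgue_measure R).-integrable `[a, b] (EFin \o (fun t => complex.Im (F t))).
Proof.
move=> HF; split; apply: lipschitz_at_integrable => t _; have [L h] := HF t;
  have [M [d [M0 d0 Hd]]] := expands_lip (fun=> normr_ge0 _) h;
  exists M, d; split => // u /Hd; apply: le_trans.
  by apply: le_trans (normc_Re _); case: (F u) (F t) => [? ?] [? ?].
by apply: le_trans (normc_Im _); case: (F u) (F t) => [? ?] [? ?].
Qed.

Definition cint (R : realType) (F : R -> R[i]) : R[i] :=
  (\int[@lebesgue_measure R]_(t in `[0, pi *+ 2]) complex.Re (F t)) +i*
  (\int[@lebesgue_measure R]_(t in `[0, pi *+ 2]) complex.Im (F t)).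

Lemma eq_cint (R : realType) (F G : R -> R[i]) : F =1 G -> cint F = cint G.
Proof. by move=> FG; rewrite (_ : F = G)//; exact/funext. Qed.

Lemma cintD (R : realType) (F G : R -> R[i]) : cdiff F -> cdiff G ->
  cint (fun t => F t + G t) = cint F + cint G.
Proof.
move=> /(@cdiff_integrable R _ 0 (pi *+ 2))[F1 F2] /(@cdiff_integrable R _ 0 (pi *+ 2))[G1 G2].
rewrite /cint; simpc; rewrite -!RintegralD//.
by congr (_ +i* _); apply: eq_Rintegral => t _; case: (F t) (G t) => [? ?] [? ?].
Qed.

Lemma cintZ (R : realType) (c : R[i]) (F : R -> R[i]) : cdiff F ->
  cint (fun t => c * F t) = c * cint F.
Proof.
move=> /(@cdiff_integrable R _ 0 (pi *+ 2))[F1 F2]; rewrite /cint.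
case: c => a b; simpc; rewrite -!RintegralZl//.
rewrite -RintegralB ?integrable_EFinZ// -RintegralD ?integrable_EFinZ//.
by congr (_ +i* _); apply: eq_Rintegral => t _; case: (F t) => [? ?].
Qed.

Lemma cint_conj (R : realType) (F : R -> R[i]) : cdiff F ->
  cint (fun t => (F t)^*) = (cint F)^*.
Proof.
move=> /(@cdiff_integrable R _ 0 (pi *+ 2))[F1 F2]; rewrite /cint /=.
congr (_ +i* _); first by apply: eq_Rintegral => t _; case: (F t).
rewrite -mulN1r -RintegralZl//.
by apply: eq_Rintegral => t _; case: (F t) => ? ? /=; rewrite mulN1r.
Qed.

Lemma cint_cst (R : realType) (c : R[i]) : cint (fun _ : R => c) = (pi *+ 2)%:C * c.
Proof.
have p0 : 0 < pi *+ 2 :> R by rewrite pmulrn_lgt0// pi_gt0.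
rewrite /cint !Rintegral_itv_cst ?(ltW p0)// subr0.
by case: c => a b /=; simpc; rewrite ![_ * (pi *+ 2)]mulrC.
Qed.

(** The constant is twice the length of the period because real and imaginary parts are estimated
    separately; the estimates below only use that it is fixed. *)
Lemma normc_cint (R : realType) (F : R -> R[i]) (M : R) : cdiff F ->
  (forall t, 0 <= t <= pi *+ 2 -> normc (F t) <= M) -> normc (cint F) <= pi *+ 4 * M.
Proof.
move=> /(@cdiff_integrable R _ 0 (pi *+ 2))[F1 F2] HM.
have p0 : 0 <= pi *+ 2 :> R by rewrite mulrn_wge0// pi_ge0.
apply: le_trans (normc_le_ReIm _ _) _.
have := Rintegral_near_cst (c := 0) (e := M) p0 F1.
have := Rintegral_near_cst (c := 0) (e := M) p0 F2.
rewrite !mul0r !subr0 => h1 h2.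
rewrite (_ : pi *+ 4 * M = M * pi *+ 2 + M * pi *+ 2); last by ring.
rewrite -!mulrnAr; apply: lerD; [apply: h2|apply: h1] => x x2; rewrite subr0.
  exact: le_trans (normc_Re _) (HM x x2).
exact: le_trans (normc_Im _) (HM x x2).
Qed.

Lemma ler_dist_normc (R : realType) (x y : R[i]) : `|normc x - normc y| <= normc (x - y).
Proof.
have h (a b : R[i]) : normc a - normc b <= normc (a - b).
  by rewrite lerBlDr -{1}(subrK b a); exact: ler_normcD.
by rewrite ler_norml h andbT lerNl opprB normcBC h.
Qed.

Lemma cdiff_bounded (R : realType) (F : R -> R[i]) : cdiff F ->
  exists2 M, 0 <= M & forall t, 0 <= t <= pi *+ 2 -> normc (F t) <= M.
Proof.
move=> HF; have p0 : 0 <= pi *+ 2 :> R by rewrite mulrn_wge0// pi_ge0.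
have [|c _ Hc] := @EVT_max R (fun t => normc (F t)) 0 (pi *+ 2) p0.
  apply: lipschitz_at_continuous => t _; have [L h] := HF t.
  have [M [d [M0 d0 Hd]]] := expands_lip (fun=> normr_ge0 _) h.
  exists M, d; split => // u /Hd; apply: le_trans; exact: ler_dist_normc.
by exists (normc (F c)) => [|t t2]; [exact: normc_ge0|apply: Hc; rewrite in_itv].
Qed.

(** * Cauchy's formula on circles *)

Definition circ (R : realType) (r t : R) : R[i] := r%:C * cis t.

(** On [z = circ r t] one has [dz = i z dt], so this is the density of [dz / (i (z - w))] with
    respect to [dt]. *)
Definition cauchy_kernel (R : realType) (w : R[i]) (r t : R) : R[i] :=
  circ r t / (circ r t - w).

Lemma normc_circ (R : realType) (r t : R) : 0 <= r -> normc (circ r t) = r.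
Proof. by move=> r0; rewrite Normc.normcM normc_cis mulr1 normc_real ger0_norm. Qed.

Lemma circ_sub_ge (R : realType) (w : R[i]) (r t : R) : 0 <= r ->
  r - normc w <= normc (circ r t - w).
Proof.
move=> r0; rewrite lerBlDr -{1}(normc_circ t r0) -{1}(subrK w (circ r t)).
exact: ler_normcD.
Qed.

Lemma circ_sub_neq0 (R : realType) (w : R[i]) (r t : R) : normc w < r -> circ r t - w != 0.
Proof.
move=> wr; have r0 : 0 <= r := le_trans (normc_ge0 _) (ltW wr).
apply/eqP => E; have := circ_sub_ge w t r0; rewrite E Normc.normc0 subr_le0.
by rewrite leNgt wr.
Qed.

Lemma normc_cauchy_kernel (R : realType) (w : R[i]) (r t : R) : normc w < r ->
  normc (cauchy_kernel w r t) <= r / (r - normc w).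
Proof.
move=> wr; have r0 : 0 <= r := le_trans (normc_ge0 _) (ltW wr).
rewrite Normc.normcM Normc.normcV normc_circ// ler_wpM2l// lef_pV2 ?posrE ?subr_gt0//.
  exact: circ_sub_ge.
by apply: lt_le_trans (circ_sub_ge w t r0); rewrite subr_gt0.
Qed.

Lemma cderiv_cauchy (R : realType) (w z : R[i]) : z - w != 0 ->
  exists l, cderiv (fun z => z / (z - w)) z l.
Proof.
move=> zw; have [l hl] := cderivV zw.
have h1 : cderiv (fun z => z - w) z (1 + 0) := cderivD (cderiv_id z) (cderiv_cst (- w) z).
have h2 := cderiv_comp (f := fun z => z^-1) (g := fun z => z - w) hl h1.
by eexists; exact: (cderivM (cderiv_id z) h2).
Qed.

Lemma cdiff_circ (R : realType) (r : R) : cdiff (circ r).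
Proof. exact: cdiffM (cdiff_cst _) (@cdiff_cis R). Qed.

Lemma cdiff_cauchy_kernel (R : realType) (w : R[i]) (r : R) : normc w < r ->
  cdiff (cauchy_kernel w r).
Proof.
move=> wr; apply: (cdiff_comp (f := fun z => z / (z - w))); last exact: cdiff_circ.
by move=> t; apply: cderiv_cauchy; exact: circ_sub_neq0.
Qed.

Lemma homotopy_disc (R : realType) (w : R[i]) (r s t : R) :
  normc w < r -> r < 1 -> 0 <= s <= 1 -> normc (w + s%:C * (circ r t - w)) < 1.
Proof.
move=> wr r1 /andP[s0 s1]; have r0 : 0 <= r := le_trans (normc_ge0 _) (ltW wr).
have -> : w + s%:C * (circ r t - w) = (1 - s)%:C * w + s%:C * circ r t.
  by rewrite rmorphB rmorph1; ring.
apply: le_lt_trans (ler_normcD _ _) _; rewrite 2!Normc.normcM normc_circ//.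
rewrite !normc_real !ger0_norm ?subr_ge0//.
by have := normc_ge0 w; nra.
Qed.

(* The form [f(z) (ds / (i s) + K dt)], where [z = w + s (r e^(it) - w)] and [K] is
   the Cauchy kernel, is [f(z) dz / (i (z - w))] pulled back along the homotopy
   contracting the circle to [w]; hence it is closed. *)
Lemma cauchy_homotopy (R : realType) (f : CC R -> CC R) (w : R[i]) (r s : R) :
  holo_disc f -> normc w < r -> r < 1 -> 0 < s <= 1 ->
  cint (fun t => f (w + s%:C * (circ r t - w)) * cauchy_kernel w r t) =
  cint (fun t => f (circ r t) * cauchy_kernel w r t).
Proof.
move=> /holo_discP hf wr r1 /andP[s0 s1].
pose Z (p : R * R) := w + p.1%:C * (circ r p.2 - w).
pose P (p : R * R) : R[i] := - 'i * (f (Z p) * (p.1%:C)^-1).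
pose Q (p : R * R) : R[i] := f (Z p) * cauchy_kernel w r p.2.
have cl u v : s <= u <= s + (1 - s) -> 0 <= v <= 0 + pi *+ 2 ->
  closed_form_at (fun u v => complex.Re (P (u, v))) (fun u v => complex.Re (Q (u, v))) u v /\
  closed_form_at (fun u v => complex.Im (P (u, v))) (fun u v => complex.Im (Q (u, v))) u v.
  move=> /andP[su]; rewrite addrC subrK => u1 _.
  have u0 : u%:C != 0 :> R[i] by rewrite (inj_eq (@complexI R) u 0) gt_eqF//; lra.
  have N0 (p : R * R) : 0 <= `|p.1 - u| + `|p.2 - v| by rewrite addr_ge0.
  have e1 := expands_fst u v.
  have e2 := @expands_snd R _ _ u v (cis_expands v).
  have ec := expandsM N0 (expands_cst r%:C N0) e2.
  have ez := expandsD (expands_cst w N0)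
               (expandsM N0 e1 (expandsD ec (expands_cst (- w) N0))).
  have Zd : normc (Z (u, v)) < 1 by apply: homotopy_disc => //; apply/andP; split => /=; lra.
  have [l hl] := hf _ Zd.
  have ef := expands_comp N0 hl ez.
  have [l1 hl1] := cderivV u0.
  have ei := expands_comp N0 hl1 e1.
  have [l2 hl2] := cderiv_cauchy (circ_sub_neq0 v wr).
  have ek := expands_comp N0 hl2 ec.
  have eP := expandsM N0 (expands_cst (- 'i) N0) (expandsM N0 ef ei).
  have eQ := expandsM N0 ef ek.
  (* The cross derivatives agree: in [P] the factor [s] from differentiating [Z] in [t] cancels
     against [1 / s] and [- 'i] against ['i]; in [Q] the factor [circ r v - w] cancels the
     denominator of the kernel. Both give [l * circ r v]. *)
  apply: (closed_form_at_expands (A := - 'i * (l * (circ r v - w) / u%:C + f (Z (u, v)) * l1))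
   (B := l * circ r v) (D := l * u%:C * 'i * circ r v * cauchy_kernel w r v +
      f (Z (u, v)) * l2 * 'i * circ r v) eP eQ) => p.
    have i2 : 'i * 'i = -1 :> R[i] by rewrite -expr2 sqr_i.
    rewrite /circ; field: i2; exact: u0.
  rewrite /cauchy_kernel; have := circ_sub_neq0 v wr; rewrite /circ => h.
  by field; exact: h.
have h0 : 0 <= 1 - s by lra.
have p0 : 0 <= pi *+ 2 :> R by rewrite mulrn_wge0// pi_ge0.
(* By periodicity the edges [t = 0] and [t = 2 pi] cancel, leaving only the two circles. *)
have per x : P (x, 0 + pi *+ 2) = P (x, 0) by rewrite /P /Z /circ /= add0r cis2pi.
have E1 : s + (1 - s) = 1 by ring.
have R1 := rect_int_eq0 h0 p0 (closed_form_rect_integrable (fun u v hu hv => (cl u v hu hv).1))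
  (fun u v hu hv => (cl u v hu hv).1).
have R2 := rect_int_eq0 h0 p0 (closed_form_rect_integrable (fun u v hu hv => (cl u v hu hv).2))
  (fun u v hu hv => (cl u v hu hv).2).
have Z1 t : Z (1, t) = circ r t by rewrite /Z /= mul1r addrC subrK.
move: R1 R2; rewrite /rect_int E1 add0r.
under [X in _ - X + _]eq_Rintegral do rewrite -[pi *+ 2]add0r per.
rewrite subrr add0r => /eqP; rewrite subr_eq0 => /eqP R1.
under [X in _ - X + _]eq_Rintegral do rewrite -[pi *+ 2]add0r per.
rewrite subrr add0r => /eqP; rewrite subr_eq0 => /eqP R2.
rewrite /cint; congr (_ +i* _).
  by rewrite -[LHS]R1; apply: eq_Rintegral => t _; rewrite /Q Z1.
by rewrite -[LHS]R2; apply: eq_Rintegral => t _; rewrite /Q Z1.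
Qed.

Lemma normc_eq0_le (R : realType) (z : R[i]) (M : R) :
  (forall e, 0 < e -> normc z <= M * e) -> z = 0.
Proof.
move=> H; apply: Normc.eq0_normc; apply/eqP; rewrite eq_le normc_ge0 andbT.
apply/ler_addgt0Pl => e e0; rewrite addr0.
have m0 : 0 < `|M| + 1 by rewrite ltr_wpDl.
apply: le_trans (H (e / (`|M| + 1)) (divr_gt0 e0 m0)) _.
rewrite mulrA ler_pdivrMr// mulrC ler_wpM2l ?(ltW e0)//.
by apply: le_trans (ler_norm _) _; rewrite lerDl.
Qed.

(** Contracting the circle towards [w] turns [f] into the constant [f w], up to an error linear in
    [s]. The integral of the kernel stays on the right until the geometric expansion gives its
    value. *)
Lemma cauchy_circle (R : realType) (f : CC R -> CC R) (w : R[i]) (r : R) :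
  holo_disc f -> normc w < r -> r < 1 ->
  cint (fun t => f (circ r t) * cauchy_kernel w r t) = f w * cint (cauchy_kernel w r).
Proof.
move=> hf wr r1; have r0 : 0 <= r := le_trans (normc_ge0 _) (ltW wr).
have w1 : normc w < 1 := lt_trans wr r1.
have dK := cdiff_cauchy_kernel wr.
apply/eqP; rewrite -subr_eq0; apply/eqP.
apply: (@normc_eq0_le _ _ (pi *+ 4 * (r / (r - normc w)))) => e e0.
have [l hl] := (holo_discP f).1 hf w w1.
have [A [d [A0 d0 HA]]] := expands_lip (fun=> normc_ge0 _) hl.
(* Points of the circle are within 2 of [w], so those of the contracted one are within [2 * s]: the
   second bound puts them in the range of the Lipschitz estimate, the third makes
   [A * (s * 2) <= e]. *)
pose s := Num.min 1 (Num.min (d / 2) (e / A / 2)).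
have s0 : 0 < s by rewrite !lt_min ltr01 !divr_gt0.
have : s <= s by []; rewrite {2}/s !le_min => /and3P[s1 sd se].
have s01 : 0 < s <= 1 by rewrite s0.
rewrite -(cauchy_homotopy hf wr r1 s01).
have dZ : cdiff (fun t => w + s%:C * (circ r t - w)).
  exact: cdiffD (cdiff_cst _) (cdiffM (cdiff_cst _) (cdiffD (@cdiff_circ R r) (cdiff_cst _))).
have dfZ : cdiff (fun t => f (w + s%:C * (circ r t - w))).
  apply: cdiff_comp dZ => t; apply/(holo_discP f).1 => //.
  by apply: homotopy_disc => //; rewrite (ltW s0).
rewrite -mulNr -cintZ// -cintD; last 2 first.
- exact: cdiffM.
- exact: cdiffM (cdiff_cst _) dK.
rewrite -mulrA; apply: normc_cint.
  by apply: cdiffD; [exact: cdiffM|exact: cdiffM (cdiff_cst _) dK].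
move=> t _; rewrite -mulrDl Normc.normcM mulrC; apply: ler_pM; rewrite ?normc_ge0//.
  exact: normc_cauchy_kernel.
have n2 : normc (circ r t - w) <= 2.
  apply: le_trans (ler_normcD _ _) _; rewrite normcNE normc_circ//; lra.
have n3 : normc (w + s%:C * (circ r t - w) - w) <= s * 2.
  rewrite addrC addKr Normc.normcM normc_real ger0_norm ?(ltW s0)//.
  by rewrite ler_wpM2l// ltW.
apply: le_trans (HA _ _) _; first by lra.
apply: (@le_trans _ _ (A * (s * 2))); first by rewrite ler_wpM2l// ltW.
by move: se; rewrite ler_pdivlMr// ler_pdivlMr// mulrC.
Qed.

(** * Taylor expansions with a geometric error *)

Lemma normc_eq0_geometric (R : realType) (z : R[i]) (C q : R) : 0 <= C -> 0 <= q < 1 ->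
  (forall n, normc z <= C * q ^+ n) -> z = 0.
Proof.
move=> C0 /andP[q0 q1] H; apply: (@normc_eq0_le _ _ 1) => e e0; rewrite mul1r.
have := @cvg_geometric R C q; rewrite ger0_norm// => /(_ q1)/cvgrPdist_le/(_ e e0).
move=> [N _ /(_ N (leqnn _))]; rewrite sub0r normrN /= => HN.
by apply: le_trans (H N) _; apply: le_trans HN; exact: ler_norm.
Qed.

Lemma cdiffX (R : realType) (F : R -> R[i]) n : cdiff F -> cdiff (fun t => F t ^+ n).
Proof. by apply: (cdiff_comp (f := fun z => z ^+ n)) => t; exact: cderivX. Qed.

Lemma circ_neq0 (R : realType) (r t : R) : 0 < r -> circ r t != 0.
Proof.
by move=> r0; have := @circ_sub_neq0 R 0 r t; rewrite subr0; apply; rewrite Normc.normc0.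
Qed.

Lemma cdiff_circV (R : realType) (r : R) : 0 < r -> cdiff (fun t => (circ r t)^-1).
Proof.
move=> r0; apply: (cdiff_comp (f := fun z => z^-1)); last exact: cdiff_circ.
by move=> t; apply: cderivV; exact: circ_neq0.
Qed.

Lemma circV (R : realType) (r t : R) : 0 < r ->
  (circ r t)^-1 = (r^-1 ^+ 2)%:C * (circ r t)^*.
Proof.
move=> r0; apply: (mulfI (circ_neq0 t r0)); rewrite divff ?circ_neq0//.
rewrite mulrCA -[X in _ * X](_ : (r ^+ 2)%:C = _).
  by rewrite -rmorphM -exprMn mulVf ?expr1n// gt_eqF.
rewrite /circ /cis; simpc; congr (_ +i* _); last by ring.
by rewrite -[LHS]mulr1 -(cos2Dsin2 t); ring.
Qed.

(** At [w = 0] the kernel is 1 and the power vanishes, so this is an instance of [cauchy_circle]. *)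
Lemma cint_circX (R : realType) (r : R) n : 0 < r -> r < 1 -> (0 < n)%N ->
  cint (fun t => circ r t ^+ n) = 0.
Proof.
move=> r0 r1 n0.
have hf : holo_disc (fun z : CC R => (z : R[i]) ^+ n).
  by apply/holo_discP => z _; exact: cderivX.
have w0 : normc (0 : R[i]) < r by rewrite Normc.normc0.
have := cauchy_circle hf w0 r1; rewrite expr0n (gtn_eqF n0) mul0r => <-.
by apply: eq_cint => t; rewrite /cauchy_kernel subr0 divff ?mulr1// circ_neq0.
Qed.

(** On a circle centred at 0 the inverse is a real multiple of the conjugate, which reduces negative
    powers to positive ones. *)
Lemma cint_circVX (R : realType) (r : R) n : 0 < r -> r < 1 -> (0 < n)%N ->
  cint (fun t => (circ r t)^-1 ^+ n) = 0.
Proof.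
move=> r0 r1 n0.
transitivity (cint (fun t => ((r^-1 ^+ 2)%:C ^+ n * circ r t ^+ n)^*)).
  apply: eq_cint => t; rewrite circV// -[in RHS]exprMn [RHS]rmorphXn.
  by rewrite [X in _ = X ^+ _]rmorphM; congr ((_ * _) ^+ _); exact/esym/conjc_real.
rewrite cint_conj; last by apply: cdiffM (cdiff_cst _) _; apply/cdiffX/cdiff_circ.
by rewrite cintZ ?cint_circX ?mulr0 ?conjc0//; apply/cdiffX/cdiff_circ.
Qed.

Lemma cauchy_kernel_recr (R : realType) (w : R[i]) (r t : R) : normc w < r ->
  cauchy_kernel w r t = 1 + w * ((circ r t)^-1 * cauchy_kernel w r t).
Proof.
move=> wr; have r0 : 0 < r := le_lt_trans (normc_ge0 _) wr.
have h1 := circ_neq0 t r0; have h2 := circ_sub_neq0 t wr.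
by rewrite /cauchy_kernel mulKf// -[X in _ = X + _](divff h2) -mulrDl subrK.
Qed.

(** Iterating [K = 1 + (w / z) K] gives a finite geometric sum with an exact remainder, so sum and
    integral never have to be interchanged in a limit. *)
Lemma cint_cauchy_geometric (R : realType) (G : R -> R[i]) (w : R[i]) (r : R) n :
  cdiff G -> normc w < r ->
  cint (fun t => G t * cauchy_kernel w r t) =
  \sum_(k < n) cint (fun t => G t * (circ r t)^-1 ^+ k) * w ^+ k +
  w ^+ n * cint (fun t => G t * (circ r t)^-1 ^+ n * cauchy_kernel w r t).
Proof.
move=> dG wr; have r0 : 0 < r := le_lt_trans (normc_ge0 _) wr.
have dK := cdiff_cauchy_kernel wr.
have dV k : cdiff (fun t => G t * (circ r t)^-1 ^+ k).
  by apply: cdiffM dG _; apply/cdiffX/cdiff_circV.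
elim: n => [|n IH].
  by rewrite big_ord0 add0r expr0 mul1r; apply: eq_cint => t; rewrite expr0 mulr1.
rewrite IH big_ord_recr /= -addrA; congr (_ + _).
rewrite [in LHS](@eq_cint _ _ (fun t => G t * (circ r t)^-1 ^+ n +
   w * (G t * (circ r t)^-1 ^+ n.+1 * cauchy_kernel w r t))); last first.
  by move=> t; rewrite {1}cauchy_kernel_recr// exprS; ring.
rewrite cintD ?cintZ//; last by apply: cdiffM (cdiff_cst _) _; exact: cdiffM.
  by rewrite exprS; ring.
exact: cdiffM.
Qed.

Lemma cint_cauchy_remainder (R : realType) (G : R -> R[i]) (w : R[i]) (r M : R) n :
  cdiff G -> normc w < r -> (forall t, 0 <= t <= pi *+ 2 -> normc (G t) <= M) ->
  normc (w ^+ n * cint (fun t => G t * (circ r t)^-1 ^+ n * cauchy_kernel w r t)) <=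
  pi *+ 4 * (M * (r / (r - normc w))) * (normc w / r) ^+ n.
Proof.
move=> dG wr HM; have r0 : 0 < r := le_lt_trans (normc_ge0 _) wr.
rewrite Normc.normcM normc_X.
apply: (@le_trans _ _ (normc w ^+ n *
   (pi *+ 4 * (M * r^-1 ^+ n * (r / (r - normc w)))))); last first.
  by rewrite le_eqVlt; apply/orP; left; apply/eqP; rewrite exprMn; ring.
rewrite ler_wpM2l ?exprn_ge0 ?normc_ge0//; apply: normc_cint.
  apply: cdiffM (cdiff_cauchy_kernel wr); apply: cdiffM dG _.
  exact/cdiffX/cdiff_circV.
move=> t t2; rewrite Normc.normcM; apply: ler_pM => //; rewrite ?normc_ge0//.
  rewrite Normc.normcM normc_X Normc.normcV normc_circ ?(ltW r0)//.
  by rewrite ler_wpM2r ?exprn_ge0 ?invr_ge0 ?(ltW r0)// HM.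
exact: normc_cauchy_kernel.
Qed.

(** In the geometric expansion with [G = 1] all terms but the zeroth are integrals of negative
    powers and vanish, while the remainder tends to 0. *)
Lemma cint_cauchy_kernel (R : realType) (w : R[i]) (r : R) : normc w < r -> r < 1 ->
  cint (cauchy_kernel w r) = (pi *+ 2)%:C.
Proof.
move=> wr r1; have r0 : 0 < r := le_lt_trans (normc_ge0 _) wr.
apply/eqP; rewrite -subr_eq0; apply/eqP.
(* The expansion is cut at [n.+1], so that the zeroth term is always present; this moves one factor
   [normc w / r] into the constant. *)
apply: (@normc_eq0_geometric _ _ (pi *+ 4 * (1 * (r / (r - normc w))) * (normc w / r))
   (normc w / r)).
- rewrite !mulr_ge0 ?normc_ge0 ?invr_ge0 ?subr_ge0 ?(ltW r0) ?(ltW wr)//.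
  by rewrite mulrn_wge0// pi_ge0.
- by rewrite divr_ge0 ?normc_ge0 ?(ltW r0)//= ltr_pdivrMr// mul1r.
move=> n; rewrite -mulrA -exprS.
have h1 (t : R) : 0 <= t <= pi *+ 2 -> normc (1 : R[i]) <= 1 by rewrite Normc.normc1.
apply: le_trans (@cint_cauchy_remainder R (fun=> 1) w r 1 n.+1 (cdiff_cst _) wr h1).
rewrite (@eq_cint _ (cauchy_kernel w r) (fun t => 1 * cauchy_kernel w r t)); last first.
  by move=> t; rewrite mul1r.
rewrite (cint_cauchy_geometric n.+1 (cdiff_cst _) wr) big_ord_recl /= big1 => [|k _].
  rewrite addr0 expr0 mulr1 (@eq_cint _ _ (fun=> 1)) => [|t]; last by rewrite expr0 mulr1.
  by rewrite cint_cst mulr1 addrAC subrr add0r.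
rewrite (@eq_cint _ _ (fun t => (circ r t)^-1 ^+ (lift ord0 k))); last first.
  by move=> t; rewrite mul1r.
by rewrite cint_circVX// mul0r.
Qed.

(** Cauchy's formula is used on the circle halfway between [rho] and 1, so the error ratio is
    [rho / r < 1]. The coefficients are integrals over that circle and thus depend on [rho] as
    constructed; [taylor] removes this dependence. *)
Lemma taylor_approx (R : realType) (f : CC R -> CC R) (rho : R) :
  holo_disc f -> 0 <= rho < 1 ->
  exists (a : nat -> R[i]) (C q : R), [/\ 0 <= C, 0 <= q < 1 &
    forall n (w : R[i]), normc w <= rho ->
      normc (f w - \sum_(k < n) a k * w ^+ k) <= C * q ^+ n].
Proof.
move=> hf /andP[rho0 rho1]; pose r := (1 + rho) / 2.
have r1 : r < 1 by rewrite /r; lra.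
have rr : rho < r by rewrite /r; lra.
have r0 : 0 < r := le_lt_trans rho0 rr.
have dG : cdiff (fun t => f (circ r t)).
  apply: cdiff_comp (@cdiff_circ R r) => t; apply/(holo_discP f).1 => //.
  by rewrite normc_circ// ltW.
have [M M0 HM] := cdiff_bounded dG.
have p0 : 0 < pi *+ 2 :> R by rewrite pmulrn_lgt0// pi_gt0.
exists (fun k => cint (fun t => f (circ r t) * (circ r t)^-1 ^+ k) / (pi *+ 2)%:C).
exists (2 * (M * (r / (r - rho)))), (rho / r); split.
- have h := ltW rr; have h' := ltW r0.
  by apply: mulr_ge0 => //; apply: mulr_ge0 => //; rewrite divr_ge0// subr_ge0.
- by rewrite divr_ge0 ?(ltW r0)//= ltr_pdivrMr// mul1r.
move=> n w wrho; have wr := le_lt_trans wrho rr.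
have := cauchy_circle hf wr r1; rewrite cint_cauchy_kernel// => E.
have pc : (pi *+ 2)%:C != 0 :> R[i].
  by apply/eqP => -[] /eqP; rewrite gt_eqF.
have -> : f w = cint (fun t => f (circ r t) * cauchy_kernel w r t) / (pi *+ 2)%:C.
  by rewrite E mulfK.
rewrite (cint_cauchy_geometric n dG wr) mulrDl big_distrl /=.
rewrite (eq_bigr (fun k : 'I_n => cint (fun t => f (circ r t) * (circ r t)^-1 ^+ k)
   / (pi *+ 2)%:C * w ^+ k)) => [|k _]; last by rewrite mulrAC.
rewrite addrAC subrr add0r Normc.normcM Normc.normcV normc_real (ger0_norm (ltW p0)).
rewrite ler_pdivrMr//; apply: le_trans (cint_cauchy_remainder n dG wr HM) _.
rewrite (_ : _ * _ * (pi *+ 2) = pi *+ 4 * (M * (r / (r - rho))) * (rho / r) ^+ n); last by ring.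
have p4 : 0 <= pi *+ 4 :> R by rewrite mulrn_wge0// pi_ge0.
have rw : 0 < r - normc w by rewrite subr_gt0.
have rrho : 0 < r - rho by rewrite subr_gt0.
apply: ler_pM.
- have h := ltW rw; have h' := ltW r0.
  by do 2 (apply: mulr_ge0 => //); rewrite divr_ge0.
- by rewrite exprn_ge0// divr_ge0 ?normc_ge0// ltW.
- do 2 (apply: ler_wpM2l => //); apply: ler_wpM2l; first exact: ltW.
  by rewrite lef_pV2 ?posrE// lerB.
- have h : normc w / r <= rho / r by rewrite ler_wpM2r// invr_ge0 ltW.
  have h0 : 0 <= normc w / r by rewrite divr_ge0 ?normc_ge0// ltW.
  by apply: lerXn2r => //; rewrite nnegrE// (le_trans h0 h).
Qed.

(** * Invariance of area under rotations *)

Local Notation plane R := (measurableTypeR R * measurableTypeR R)%type.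

Lemma measurable_affine (R : realType) (k c : R) :
  measurable_fun [set: measurableTypeR R]
    ((fun x => k * x + c) : measurableTypeR R -> measurableTypeR R).
Proof. by apply: measurable_funD => //; exact: mulrl_measurable. Qed.

Definition affine_pushforward (R : realType) (k c : R) :
    {measure set (measurableTypeR R) -> \bar R} :=
  @measure_function_pushforward__canonical__measure_function_Measure
    _ _ _ _ _ (lebesgue_measure : {measure set (measurableTypeR R) -> \bar R}) _
    (measurable_affine k c).

(** Uniqueness of Lebesgue measure: the rescaled image measure has the right value on half-open
    intervals. *)
Lemma lebesgue_measure_affine (R : realType) (k c : R) (A : set (R)) :
  0 < k -> measurable A ->
  lebesgue_measure A = (k%:E * pushforward (@lebesgue_measure R)
    (fun x : R => k * x + c)%R A)%E.
Proof.
move=> k0 mA.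
pose kn : {nonneg R} := NngNum (ltW k0).
pose m : {measure set (measurableTypeR R) -> \bar R} := mscale kn (affine_pushforward k c).
rewrite [LHS](@lebesgue_measure_unique R m)// => _ [[a b] _ <-] /=.
rewrite /m /mscale /= /pushforward.
have -> : (fun x : R => k * x + c) @^-1` `]a, b] = `](a - c) / k, (b - c) / k]%classic.
  apply/seteqP; split => x; rewrite /preimage /= !in_itv/= ltr_pdivrMr// ler_pdivlMr//
    ltrBlDr lerBrDr [x * k]mulrC//.
rewrite !lebesgue_measure_itv/= !lte_fin ltr_pM2r ?invr_gt0// ltrD2r.
case: ifP => _; last by rewrite mule0.
by rewrite -!EFinD -EFinM; congr (_%:E); field; rewrite gt_eqF.
Qed.

Lemma ge0_integral_affine (R : realType) (k c : R) (f : R -> \bar R) :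
  0 < k -> measurable_fun setT f -> (forall x, (0 <= f x)%E) ->
  (\int[@lebesgue_measure R]_x f x = k%:E * \int[@lebesgue_measure R]_x f (k * x + c)%R)%E.
Proof.
move=> k0 mf f0.
pose kn : {nonneg R} := NngNum (ltW k0).
rewrite (@eq_measure_integral _ _ _ _ (mscale kn (affine_pushforward k c))); last first.
  by move=> A mA _; exact: (lebesgue_measure_affine c k0 mA).
rewrite ge0_integral_mscale//; congr (_ * _)%E.
by rewrite (ge0_integral_pushforward (measurable_affine k c)).
Qed.

Lemma measurable_shear1 (R : realType) (t : R) :
  measurable_fun [set: plane R]
   (fun p : plane R => (p.1 + t * p.2, p.2) : plane R).
Proof.
apply: measurable_fun_pair; last exact: measurable_snd.
apply: measurable_funD; first exact: measurable_fst.
by apply: measurable_funM => //; exact: measurable_snd.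
Qed.

Lemma measurable_shear2 (R : realType) (t : R) :
  measurable_fun [set: plane R]
   (fun p : plane R => (p.1, p.2 + t * p.1) : plane R).
Proof.
apply: measurable_fun_pair; first exact: measurable_fst.
apply: measurable_funD; first exact: measurable_snd.
by apply: measurable_funM => //; exact: measurable_fst.
Qed.

(** After Tonelli, the inner integral for a fixed second coordinate is merely translated. *)
Lemma ge0_integral_shear1 (R : realType) (t : R)
    (f : plane R -> \bar R) :
  measurable_fun setT f -> (forall p, (0 <= f p)%E) ->
  (\int[area R]_p f (p.1 + t * p.2, p.2)%R = \int[area R]_p f p)%E.
Proof.
move=> mf f0; rewrite fubini_tonelli2//; last first.
  exact: (measurableT_comp mf (measurable_shear1 t)).
rewrite [RHS]fubini_tonelli2//; apply: eq_integral => y _; rewrite /fubini_G /=.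
rewrite [RHS](@ge0_integral_affine R 1 (t * y))// ?mul1e; last first.
  by apply: measurableT_comp mf _; exact: measurable_pair2.
by apply: eq_integral => x _; rewrite mul1r.
Qed.

Lemma ge0_integral_shear2 (R : realType) (t : R)
    (f : plane R -> \bar R) :
  measurable_fun setT f -> (forall p, (0 <= f p)%E) ->
  (\int[area R]_p f (p.1, p.2 + t * p.1)%R = \int[area R]_p f p)%E.
Proof.
move=> mf f0; rewrite fubini_tonelli1//; last first.
  exact: (measurableT_comp mf (measurable_shear2 t)).
rewrite [RHS]fubini_tonelli1//; apply: eq_integral => x _; rewrite /fubini_F /=.
rewrite [RHS](@ge0_integral_affine R 1 (t * x))// ?mul1e; last first.
  by apply: measurableT_comp mf _; exact: measurable_pair1.
by apply: eq_integral => y _; rewrite mul1r.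
Qed.

Lemma ge0_integral_scale (R : realType) (k : R)
    (f : plane R -> \bar R) :
  0 < k -> measurable_fun setT f -> (forall p, (0 <= f p)%E) ->
  (\int[area R]_p f p = (k ^+ 2)%:E * \int[area R]_p f (k * p.1, k * p.2)%R)%E.
Proof.
move=> k0 mf f0.
have mk : measurable_fun [set: plane R]
   (fun p : plane R => (k * p.1, k * p.2) : plane R).
  by apply: measurable_fun_pair; exact: measurable_funM.
have mfk := measurableT_comp mf mk.
rewrite fubini_tonelli1// [in RHS]fubini_tonelli1//.
rewrite (@ge0_integral_affine R k 0)//; last 2 first.
- exact: measurable_fun_fubini_tonelli_F.
- by move=> x; exact: integral_ge0.
rewrite expr2 EFinM -muleA; congr (_ * _)%E.
rewrite -ge0_integralZl//; last 3 first.
- exact: measurable_fun_fubini_tonelli_F.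
- by move=> x _; exact: integral_ge0.
- by rewrite lee_fin ltW.
apply: eq_integral => x _; rewrite /fubini_F /= addr0.
rewrite (@ge0_integral_affine R k 0)//; last first.
  by apply: measurableT_comp mf _; exact: measurable_pair1.
by congr (_ * _)%E; apply: eq_integral => y _; rewrite addr0.
Qed.

Definition rot (R : realType) (c s : R) (p : plane R) : plane R :=
  (c * p.1 - s * p.2, s * p.1 + c * p.2).

(* A rotation is a product of three shears, with [t = - tan (theta / 2)]. *)
Lemma ge0_integral_rot (R : realType) (c s : R)
    (f : plane R -> \bar R) :
  c ^+ 2 + s ^+ 2 = 1 -> c != -1 ->
  measurable_fun setT f -> (forall p, (0 <= f p)%E) ->
  (\int[area R]_p f (rot c s p) = \int[area R]_p f p)%E.
Proof.
move=> cs c1 mf f0; pose t := - (s / (1 + c)).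
(* The half-turn is excluded because the tangent of half its angle is infinite. *)
have c0 : 1 + c != 0 by rewrite addrC addr_eq0.
rewrite -(ge0_integral_shear1 t mf f0).
have m1 := measurableT_comp mf (measurable_shear1 t).
rewrite -(ge0_integral_shear2 s m1 (fun=> f0 _)).
have m2 := measurableT_comp m1 (measurable_shear2 s).
rewrite -(ge0_integral_shear1 t m2 (fun=> f0 _)).
apply: eq_integral => -[x y] _ /=; congr f; rewrite /rot /=.
have tt : t * (1 + c) = - s by rewrite /t mulNr mulfVK.
have s2 : s ^+ 2 = 1 - c ^+ 2 by rewrite -cs; ring.
have ts : 1 + t * s = c.
  apply: (mulIf c0); transitivity (1 + c + s * (t * (1 + c))); first by ring.
  by rewrite tt mulrN -expr2 s2; ring.
congr (_, _).
  transitivity ((1 + t * s) * x + t * (1 + (1 + t * s)) * y); last by ring.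
  by rewrite ts tt mulNr.
by transitivity (s * x + (1 + t * s) * y); [rewrite ts|ring].
Qed.

Lemma integral_rot (R : realType) (c s : R)
    (f : plane R -> \bar R) :
  c ^+ 2 + s ^+ 2 = 1 -> c != -1 -> measurable_fun setT f ->
  (\int[area R]_p f (rot c s p) = \int[area R]_p f p)%E.
Proof.
move=> cs c1 mf; rewrite integralE [RHS]integralE.
have Ep := @ge0_integral_rot R c s (f^\+)%E cs c1 (measurable_funepos mf) (funepos_ge0 f).
have En := @ge0_integral_rot R c s (f^\-)%E cs c1 (measurable_funeneg mf) (funeneg_ge0 f).
rewrite -Ep -En; congr (_ - _)%E; apply: eq_integral => p _.
  by rewrite !funeposE.
by rewrite !funenegE.
Qed.

(** * Discs, and the finite mass of the weight *)

Definition disco (R : realType) (rho : R) : set (plane R) :=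
  [set p | p.1 ^+ 2 + p.2 ^+ 2 < rho ^+ 2].

Lemma discRE (R : realType) : discR R = disco 1.
Proof. by rewrite /disco expr1n. Qed.

Lemma measurable_sqnorm (R : realType) :
  measurable_fun [set: plane R]
   (fun p : plane R => p.1 ^+ 2 + p.2 ^+ 2 : R).
Proof.
by apply: measurable_funD; apply: measurable_funX; [exact: measurable_fst|exact: measurable_snd].
Qed.

Lemma measurable_disco (R : realType) (rho : R) :
  measurable (disco rho : set (plane R)).
Proof.
have := @measurable_sqnorm R measurableT _ (measurable_itv `]-oo, rho ^+ 2[%R).
by rewrite setTI; congr (measurable _); apply/seteqP; split => p /=; rewrite in_itv.
Qed.

Lemma integral_disco_rot (R : realType) (c s rho : R)
    (f : plane R -> \bar R) :
  c ^+ 2 + s ^+ 2 = 1 -> c != -1 -> measurable_fun (disco rho) f ->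
  (\int[area R]_(p in disco rho) f (rot c s p) = \int[area R]_(p in disco rho) f p)%E.
Proof.
move=> cs c1 mf; rewrite integral_mkcond [RHS]integral_mkcond.
rewrite -[RHS](@integral_rot R c s)//; last first.
  by apply/(measurable_restrictT _ (measurable_disco _)).
apply: eq_integral => p _; rewrite !patchE.
suff -> : (rot c s p \in disco rho) = (p \in disco rho) by [].
apply/idP/idP; rewrite !inE /disco /rot /=;
have -> : (c * p.1 - s * p.2) ^+ 2 + (s * p.1 + c * p.2) ^+ 2 =
  (c ^+ 2 + s ^+ 2) * (p.1 ^+ 2 + p.2 ^+ 2) by ring.
  by rewrite cs mul1r.
by rewrite cs mul1r.
Qed.

(** The scaling law suffices: the area of the unit disc is never computed, only bounded by that of a
    square. *)
Lemma area_disco (R : realType) (rho : R) : 0 < rho ->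
  (area R (disco rho) = (rho ^+ 2)%:E * area R (disco 1))%E.
Proof.
move=> r0; have md x := @measurable_disco R x.
have i x : (\int[area R]_p (\1_(disco x) p)%:E = area R (disco x))%E.
  by rewrite integral_indic// setIT.
rewrite -!i (@ge0_integral_scale R rho)//; last first.
  by apply/measurable_EFinP; exact: measurable_indic.
congr (_ * _)%E; apply: eq_integral => p _; congr (_%:E); rewrite !indicE; congr (_%:R).
apply: congr1; apply/idP/idP; rewrite !inE /disco /= !exprMn -mulrDr expr1n;
  by rewrite gtr_pMr ?exprn_gt0.
Qed.

Lemma area_disc_lty (R : realType) : (area R (disco 1) < +oo)%E.
Proof.
pose I : set (measurableTypeR R) := `[(-1 : R), 1]%classic.
have I2 : lebesgue_measure I = 2%:E.
  rewrite lebesgue_measure_itv/= lte_fin gtrN// -EFinD opprK.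
  by congr (_%:E); ring.
have E : (area R (I `*` I) = 4%:E)%E.
  transitivity (2%:E * 2%:E : \bar R)%E; last by rewrite -EFinM; congr (_%:E); ring.
  by rewrite -I2; apply: product_measure1E; exact: measurable_itv.
apply: (@le_lt_trans _ _ 4%:E); last exact: ltry.
rewrite -E; apply: le_measure; rewrite ?inE//.
- exact: measurable_disco.
- by apply: measurableX; exact: measurable_itv.
move=> [x y]; rewrite /disco /= expr1n => h; split; rewrite /I /= in_itv/=;
  by apply/andP; split; nra.
Qed.

Lemma ge0_integral_exhaust_le (d : measure_display) (T : measurableType d) (R : realType)
    (mu : {measure set T -> \bar R}) (E : nat -> set T) (f : T -> \bar R) (K : \bar R) :
  (forall m n, (m <= n)%N -> E m `<=` E n) -> (forall n, measurable (E n)) ->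
  (forall n, measurable_fun (E n) f) -> (forall n x, E n x -> (0 <= f x)%E) ->
  (forall n, (\int[mu]_(x in E n) f x <= K)%E) ->
  (\int[mu]_(x in \bigcup_n E n) f x <= K)%E.
Proof.
move=> ndE mE mf f0 H.
have nd : {homo E : n m / (n <= m)%N >-> (n <= m)%O}.
  by move=> m n mn; apply/subsetPset; exact: ndE.
have h := @ge0_nondecreasing_set_cvg_integral _ _ _ E f mu nd mE mf f0.
have /cvg_lim <-// : (fun n => \int[mu]_(x in E n) f x)%E @ \oo --> _ := h.
by apply: lime_le; [apply/cvg_ex; eexists; exact: h|exact: nearW].
Qed.

Lemma bweight_ge0 (R : realType) (alpha : R) (p : plane R) : 0 <= bweight alpha p.
Proof. by rewrite /bweight divr_ge0 ?powR_ge0 ?pi_ge0. Qed.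

Lemma measurable_bweight (R : realType) (alpha : R) (D : set (plane R)) :
  measurable_fun D (bweight alpha).
Proof.
apply: measurable_funTS; apply: measurable_funM => //.
apply: (measurableT_comp (measurable_powR alpha)).
by apply: measurable_funB => //; exact: measurable_sqnorm.
Qed.

(** The disc is cut into rings where [1 - |z|^2] lies between [b ^+ n.+1] and [b ^+ n], with
    [b = 1/2]. By the scaling law such a ring has area [b ^+ n.+1 * V], and the weight on it is at
    most [c ^+ n.+1 / pi] with [c = b]^ a[. The sum is geometric with ratio]q = b [^ (1 + a)], less
    than 1 exactly because [a > -1]. *)
Lemma bweight_integral_lty (R : realType) (alpha : R) : -1 < alpha ->
  (\int[area R]_(p in discR R) (bweight alpha p)%:E < +oo)%E.
Proof.
(* As [1 - |z|^2 <= 1], lowering the exponent can only increase the weight; with [a <= 0] the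
   largest weight on a ring is at its outer edge. *)
move=> ha; pose a := Num.min alpha 0.
have a1 : -1 < a by rewrite lt_min ha ltrN10.
have a0 : a <= 0 by rewrite ge_min lexx orbT.
have aa : a <= alpha by rewrite ge_min lexx.
pose b : R := 2^-1; have b0 : 0 < b by rewrite invr_gt0.
have b1 : b < 1 by rewrite /b; lra.
have bn0 n : 0 < b ^+ n by rewrite exprn_gt0.
have bn1 n : b ^+ n <= 1 by rewrite exprn_ile1// ltW.
pose E n : set (plane R) := disco (Num.sqrt (1 - b ^+ n)).
have EP n p : E n p <-> p.1 ^+ 2 + p.2 ^+ 2 < 1 - b ^+ n.
  by rewrite /E /disco /= sqr_sqrtr// subr_ge0.
have mE n : measurable (E n) by exact: measurable_disco.
have bnS n : b ^+ n.+1 = b ^+ n / 2 by rewrite exprSr.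
have E0 : E 0 = set0.
  apply/seteqP; split => // p /EP; rewrite expr0 subrr.
  by rewrite ltNge addr_ge0 ?sqr_ge0.
have ndS n : E n `<=` E n.+1.
  by move=> p /EP h; apply/EP; apply: lt_le_trans h _; rewrite bnS; have := bn0 n; lra.
have nd m n : (m <= n)%N -> E m `<=` E n.
  move=> /subnK <-; elim: (n - m)%N => [|k IH]; first by rewrite add0n.
  by rewrite addSn; exact: subset_trans IH (ndS _).
have UE : \bigcup_n E n = discR R.
  apply/seteqP; split => [p [n _ /EP h]|p]; rewrite /discR /=.
    by apply: lt_trans h _; have := bn0 n; lra.
  rewrite -subr_gt0 => h.
  have := @cvg_geometric R 1 b; rewrite ger0_norm ?(ltW b0)// => /(_ b1)/cvgrPdist_lt/(_ _ h).
  move=> [N _ /(_ N (leqnn _))]; rewrite sub0r normrN /= mul1r => HN.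
  by exists N => //; apply/EP; have := ler_norm (b ^+ N); lra.
have Vf := area_disc_lty R.
pose V := fine (area R (disco 1)).
have VE : (area R (disco 1) = V%:E)%E by rewrite fineK// ge0_fin_numE.
have V0 : 0 <= V by rewrite fine_ge0.
have areaE n : (area R (E n) = ((1 - b ^+ n) * V)%:E)%E.
  case: n => [|n]; first by rewrite E0 expr0 subrr mul0r; exact: measure0.
  have b1n : b ^+ n.+1 < 1 by rewrite exprn_ilt1// ltW.
  rewrite area_disco ?sqrtr_gt0 ?subr_gt0// VE -EFinM sqr_sqrtr// subr_ge0//.
pose c := b `^ a; pose q := b * c.
have c0 : 0 < c by rewrite powR_gt0.
have q0 : 0 < q by rewrite mulr_gt0.
have q1 : q < 1.
  have -> : q = b `^ (1 + a).
    by rewrite powRD ?powRr1 ?(ltW b0)//; apply/implyP => _; rewrite gt_eqF.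
  have := @gt0_ltr_powR R (1 + a) _ b 1; rewrite !nnegrE powR1; apply => //; last exact: ltW.
  by rewrite -ltrBlDl sub0r.
have bna n : (b ^+ n) `^ a = c ^+ n.
  rewrite -powR_mulrn ?(ltW b0)// -powRrM mulrC powRrM powR_mulrn//.
  exact: powR_ge0.
pose K := V / pi * (q / (1 - q)).
have mW (D : set (plane R)) : measurable_fun D (EFin \o bweight alpha).
  by apply/measurable_EFinP; exact: measurable_bweight.
have W0 p : (0 <= (EFin \o bweight alpha) p)%E by rewrite lee_fin bweight_ge0.
have pi0 : 0 < pi :> R := pi_gt0 R.
(* The bound is the exact partial sum of the geometric series with terms [V / pi * q ^+ k], starting
   at [k = 1], so each ring adds precisely the next term. *)
have step n : (\int[area R]_(p in E n) (bweight alpha p)%:E <= (K * (1 - q ^+ n))%:E)%E.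
  elim: n => [|n IH]; first by rewrite E0 integral_set0 expr0 subrr mulr0.
  have -> : E n.+1 = E n `|` (E n.+1 `\` E n).
    by rewrite setDUK//; exact: ndS.
  have mD : measurable (E n.+1 `\` E n) by exact: measurableD.
  have dj : [disjoint E n & E n.+1 `\` E n] by apply/disj_setPS => p [h1 [_ h2]].
  have -> := ge0_integral_setU (area R) (mE n) mD (mW _) (fun p _ => W0 p) dj.
  have -> : K * (1 - q ^+ n.+1) = K * (1 - q ^+ n) + V / pi * q ^+ n.+1.
    have q1' : 1 - q != 0 by rewrite subr_eq0 gt_eqF.
    have S1 : q / (1 - q) * (1 - q) = q by rewrite divfK.
    rewrite exprS /K -[X in _ = _ + _ * (X * _)]S1.
    by set S := q / (1 - q); set W := V / pi; ring.
  rewrite EFinD; apply: leeD => //.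
  apply: (@le_trans _ _ (\int[area R]_(p in E n.+1 `\` E n) (cst ((c ^+ n.+1 / pi)%:E) p))%E).
    apply: (@ge0_le_integral _ _ _ (area R) _ mD _ _ (fun p _ => W0 p) (mW _) (measurable_cst _)).
    move=> p [/EP h1 h2]; rewrite lee_fin /bweight /= ler_pM2r ?invr_gt0//.
    have h3 : b ^+ n.+1 <= 1 - (p.1 ^+ 2 + p.2 ^+ 2) by lra.
    have h4 : 0 < 1 - (p.1 ^+ 2 + p.2 ^+ 2) := lt_le_trans (bn0 _) h3.
    have h5 : 1 - (p.1 ^+ 2 + p.2 ^+ 2) <= 1 by rewrite gerBl addr_ge0 ?sqr_ge0.
    apply: (@le_trans _ _ ((1 - (p.1 ^+ 2 + p.2 ^+ 2)) `^ a)).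
      by apply: ger_powR => //; rewrite h4.
    have powNE x : x `^ a = (x `^ (- a))^-1 by rewrite powRN invrK.
    rewrite -bna !powNE lef_pV2 ?posrE ?powR_gt0//.
    have Na : 0 <= - a by rewrite oppr_ge0.
    have := @ge0_ler_powR R (- a) Na (b ^+ n.+1) (1 - (p.1 ^+ 2 + p.2 ^+ 2)).
    by rewrite !nnegrE; apply => //; exact: ltW.
  have AD : (area R (E n.+1 `\` E n) = (b ^+ n.+1 * V)%:E)%E.
    have fin : (area R (E n.+1) < +oo)%E by rewrite areaE ltry.
    transitivity (area R (E n.+1) - area R (E n.+1 `&` E n))%E; first exact: measureD.
    rewrite setIidr ?areaE; last exact: ndS.
    by rewrite -EFinB -mulrBl; congr ((_ * _)%:E); rewrite bnS; lra.
  have -> : (\int[area R]_(p in E n.+1 `\` E n) (cst (c ^+ n.+1 / pi)%:E p) =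
    (c ^+ n.+1 / pi)%:E * area R (E n.+1 `\` E n))%E by exact: integral_cst.
  by rewrite AD -EFinM lee_fin /q exprMn le_eqVlt; apply/orP; left; apply/eqP; ring.
apply: (@le_lt_trans _ _ K%:E); last exact: ltry.
rewrite -UE.
apply: (ge0_integral_exhaust_le nd mE (fun n => mW (E n)) (fun n p _ => W0 p)) => n.
apply: le_trans (step n) _; rewrite lee_fin ler_piMr//.
  have h1 := ltW q0; have h2 := ltW q1; have h3 := ltW pi0.
  by apply: mulr_ge0; apply: divr_ge0; rewrite ?subr_ge0.
by rewrite gerBl exprn_ge0// ltW.
Qed.

(** * Weighted integrals of complex functions *)

Lemma conjcX (R : realType) (z : R[i]) n : conjc (z ^+ n) = conjc z ^+ n.
Proof. exact: rmorphXn. Qed.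

Lemma conjcM (R : realType) (x y : R[i]) : conjc (x * y) = conjc x * conjc y.
Proof. exact: rmorphM. Qed.

Lemma conjcB (R : realType) (x y : R[i]) : conjc (x - y) = conjc x - conjc y.
Proof. exact: rmorphB. Qed.

Lemma conjc_sum (R : realType) n (F : nat -> R[i]) :
  conjc (\sum_(k < n) F k) = \sum_(k < n) conjc (F k).
Proof. exact: rmorph_sum. Qed.

Lemma sqmodE (R : realType) (z : R[i]) : sqmod z = normc z ^+ 2.
Proof. by case: z => a b; rewrite /= sqr_sqrtr// addr_ge0 ?sqr_ge0. Qed.

Lemma mulcJ_sqmod (R : realType) (z : R[i]) : z * conjc z = (sqmod z)%:C.
Proof. by case: z => a b; rewrite /sqmod /=; simpc; congr (_ +i* _); ring. Qed.

Lemma normcJ (R : realType) (z : R[i]) : normc (conjc z) = normc z.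
Proof. by case: z => a b; rewrite /= sqrrN. Qed.

Lemma ReD (R : realType) (x y : R[i]) : complex.Re (x + y) = complex.Re x + complex.Re y.
Proof. by case: x y => [? ?] [? ?]. Qed.

Lemma ImD (R : realType) (x y : R[i]) : complex.Im (x + y) = complex.Im x + complex.Im y.
Proof. by case: x y => [? ?] [? ?]. Qed.

Definition cmeas (R : realType) (E : set (plane R)) (F : plane R -> R[i]) :=
  measurable_fun E (fun p => complex.Re (F p)) /\ measurable_fun E (fun p => complex.Im (F p)).

Lemma cmeas_cst (R : realType) (E : set (plane R)) (c : R[i]) : cmeas E (fun=> c).
Proof. by split; exact: measurable_cst. Qed.

Lemma cmeas_toC (R : realType) (E : set (plane R)) : cmeas E (fun p => toC p : R[i]).
Proof.
by split; apply: measurable_funTS; [exact: measurable_fst|exact: measurable_snd].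
Qed.

Lemma cmeasD (R : realType) (E : set (plane R)) (F G : plane R -> R[i]) :
  cmeas E F -> cmeas E G -> cmeas E (fun p => F p + G p).
Proof.
move=> [F1 F2] [G1 G2]; split.
  by under eq_fun do rewrite ReD; exact: measurable_funD.
by under eq_fun do rewrite ImD; exact: measurable_funD.
Qed.

Lemma cmeasM (R : realType) (E : set (plane R)) (F G : plane R -> R[i]) :
  cmeas E F -> cmeas E G -> cmeas E (fun p => F p * G p).
Proof.
move=> [F1 F2] [G1 G2].
have ReM (x y : R[i]) : complex.Re (x * y) =
    complex.Re x * complex.Re y - complex.Im x * complex.Im y.
  by case: x y => [? ?] [? ?].
have ImM (x y : R[i]) : complex.Im (x * y) =
    complex.Re x * complex.Im y + complex.Im x * complex.Re y.
  by case: x y => [? ?] [? ?].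
split.
  by under eq_fun do rewrite ReM; apply: measurable_funB; exact: measurable_funM.
by under eq_fun do rewrite ImM; apply: measurable_funD; exact: measurable_funM.
Qed.

Lemma cmeasJ (R : realType) (E : set (plane R)) (F : plane R -> R[i]) :
  cmeas E F -> cmeas E (fun p => conjc (F p)).
Proof.
move=> [F1 F2].
have ReJ (x : R[i]) : complex.Re (conjc x) = complex.Re x by case: x.
have ImJ (x : R[i]) : complex.Im (conjc x) = - complex.Im x by case: x.
split; first by under eq_fun do rewrite ReJ.
by under eq_fun do rewrite ImJ; exact: measurable_funN.
Qed.

Lemma cmeasX (R : realType) (E : set (plane R)) (F : plane R -> R[i]) n :
  cmeas E F -> cmeas E (fun p => F p ^+ n).
Proof.
move=> mF; elim: n => [|n IH]; first by under eq_fun do rewrite expr0; exact: cmeas_cst.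
by under eq_fun do rewrite exprS; exact: cmeasM.
Qed.

Lemma cmeas_sum (R : realType) (E : set (plane R)) (F : nat -> plane R -> R[i]) n :
  (forall k, cmeas E (F k)) -> cmeas E (fun p => \sum_(k < n) F k p).
Proof.
move=> mF; elim: n => [|n IH]; first by under eq_fun do rewrite big_ord0; exact: cmeas_cst.
by under eq_fun do rewrite big_ord_recr; exact: cmeasD.
Qed.

Lemma cmeas_poly (R : realType) (E : set (plane R)) (a : nat -> R[i]) n :
  cmeas E (fun p => \sum_(k < n) a k * (toC p : R[i]) ^+ k).
Proof.
apply: (cmeas_sum (F := fun k p => a k * (toC p : R[i]) ^+ k)) => k.
by apply: cmeasM; [exact: cmeas_cst|apply: cmeasX; exact: cmeas_toC].
Qed.

Definition wint (R : realType) (alpha : R) (E : set (plane R)) (F : plane R -> R[i]) :=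
  (area R).-integrable E (EFin \o (fun p => complex.Re (F p) * bweight alpha p)) /\
  (area R).-integrable E (EFin \o (fun p => complex.Im (F p) * bweight alpha p)).

(** For [E := discR R] and an integrand [f * conj g] this unfolds to [binner]; leaving [E] free
    gives the same pairing on smaller discs. *)
Definition cI (R : realType) (alpha : R) (E : set (plane R)) (F : plane R -> R[i]) : R[i] :=
  (\int[area R]_(p in E) (complex.Re (F p) * bweight alpha p)) +i*
  (\int[area R]_(p in E) (complex.Im (F p) * bweight alpha p)).

Lemma eq_cI (R : realType) (alpha : R) (E : set (plane R)) (F G : plane R -> R[i]) :
  (forall p, E p -> F p = G p) -> cI alpha E F = cI alpha E G.
Proof.
move=> FG; rewrite /cI; congr (_ +i* _); apply: eq_Rintegral => p; rewrite inE => Ep;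
  by rewrite FG.
Qed.

Lemma cID (R : realType) (alpha : R) (E : set (plane R)) (F G : plane R -> R[i]) :
  measurable E -> wint alpha E F -> wint alpha E G ->
  cI alpha E (fun p => F p + G p) = cI alpha E F + cI alpha E G.
Proof.
move=> mE [F1 F2] [G1 G2]; rewrite /cI; simpc; rewrite -!RintegralD//.
by congr (_ +i* _); apply: eq_Rintegral => p _; rewrite ?ReD ?ImD mulrDl.
Qed.

Lemma cIZ (R : realType) (alpha : R) (E : set (plane R)) (c : R[i]) (F : plane R -> R[i]) :
  measurable E -> wint alpha E F -> cI alpha E (fun p => c * F p) = c * cI alpha E F.
Proof.
move=> mE [F1 F2]; rewrite /cI; case: c => a b; simpc; rewrite -!RintegralZl//.
rewrite -RintegralB ?integrable_EFinZ// -RintegralD ?integrable_EFinZ//.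
by congr (_ +i* _); apply: eq_Rintegral => p _; case: (F p) => ? ? /=; ring.
Qed.

Lemma wint_dom (R : realType) (alpha : R) (E : set (plane R)) (F : plane R -> R[i])
    (H : plane R -> R) :
  measurable E -> cmeas E F ->
  (area R).-integrable E (EFin \o (fun p => H p * bweight alpha p)) ->
  (forall p, E p -> normc (F p) <= H p) -> wint alpha E F.
Proof.
move=> mE [F1 F2] iH FH; split; apply: (le_integrable mE) iH.
- apply/measurable_EFinP; apply: measurable_funM => //; exact: measurable_bweight.
- move=> p Ep /=; rewrite lee_fin !normrM ler_wpM2r//.
  exact: le_trans (normc_Re _) (le_trans (FH p Ep) (ler_norm _)).
- apply/measurable_EFinP; apply: measurable_funM => //; exact: measurable_bweight.
- move=> p Ep /=; rewrite lee_fin !normrM ler_wpM2r//.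
  exact: le_trans (normc_Im _) (le_trans (FH p Ep) (ler_norm _)).
Qed.

Lemma normc_cI (R : realType) (alpha : R) (E : set (plane R)) (F : plane R -> R[i])
    (H : plane R -> R) :
  measurable E -> cmeas E F ->
  (area R).-integrable E (EFin \o (fun p => H p * bweight alpha p)) ->
  (forall p, E p -> normc (F p) <= H p) ->
  normc (cI alpha E F) <= 2 * \int[area R]_(p in E) (H p * bweight alpha p).
Proof.
move=> mE mF iH FH; have [F1 F2] := wint_dom mE mF iH FH.
apply: le_trans (normc_le_ReIm _ _) _; rewrite mulr_natl mulr2n.
apply: lerD; apply: le_trans (le_normr_Rintegral mE _) _ => //; apply: le_Rintegral => //.
- exact: (integrable_norm F1).
- move=> p Ep; rewrite normrM (ger0_norm (bweight_ge0 _ _)) ler_wpM2r ?bweight_ge0//.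
  exact: le_trans (normc_Re _) (FH p Ep).
- exact: (integrable_norm F2).
- move=> p Ep; rewrite normrM (ger0_norm (bweight_ge0 _ _)) ler_wpM2r ?bweight_ge0//.
  exact: le_trans (normc_Im _) (FH p Ep).
Qed.

Lemma wintZ (R : realType) (alpha : R) (E : set (plane R)) (c : R[i]) (F : plane R -> R[i]) :
  measurable E -> wint alpha E F -> wint alpha E (fun p => c * F p).
Proof.
move=> mE [F1 F2]; case: c => a b; split.
  have := integrable_EFinB mE (integrable_EFinZ a mE F1) (integrable_EFinZ b mE F2).
  congr (_.-integrable _ (EFin \o _)); apply/funext => p.
  by case: (F p) => ? ? /=; ring.
have := integrable_EFinD mE (integrable_EFinZ a mE F2) (integrable_EFinZ b mE F1).
congr (_.-integrable _ (EFin \o _)); apply/funext => p.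
by case: (F p) => ? ? /=; ring.
Qed.

Lemma disco_disc (R : realType) (rho : R) : 0 <= rho <= 1 -> disco rho `<=` disco 1.
Proof.
move=> /andP[r0 r1] p; rewrite /disco /= => /lt_le_trans; apply.
by rewrite expr1n exprn_ile1.
Qed.

Lemma measurable_discR (R : realType) : measurable (discR R : set (plane R)).
Proof. by rewrite discRE; exact: measurable_disco. Qed.

Lemma integrable_bweight (R : realType) (alpha : R) (E : set (plane R)) (M : R) :
  -1 < alpha -> measurable E -> E `<=` discR R ->
  (area R).-integrable E (EFin \o (fun p => M * bweight alpha p)).
Proof.
move=> ha mE ED; apply: integrable_EFinZ => //.
apply: (integrableS (@measurable_discR R) mE ED).
apply/integrableP; split; first by apply/measurable_EFinP; exact: measurable_bweight.
apply: le_lt_trans (bweight_integral_lty ha); rewrite le_eqVlt; apply/orP; left; apply/eqP.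
by apply: eq_integral => p _ /=; rewrite ger0_norm// bweight_ge0.
Qed.

Lemma normc_toC_lt (R : realType) (rho : R) (p : plane R) : 0 <= rho -> disco rho p ->
  normc (toC p : R[i]) < rho.
Proof.
move=> r0; rewrite /disco /= => h; rewrite -(ger0_norm r0) -sqrtr_sqr ltr_sqrt//.
by apply: le_lt_trans h; rewrite addr_ge0 ?sqr_ge0.
Qed.

Lemma disco_normc_lt (R : realType) (rho : R) (p : plane R) :
  normc (toC p : R[i]) < rho -> disco rho p.
Proof.
move=> h; have r0 : 0 <= rho := le_trans (normc_ge0 _) (ltW h).
rewrite /disco /= -[ltLHS]/(sqmod (toC p)) sqmodE ltrXn2r// ?nnegrE ?normc_ge0//.
Qed.

Lemma toC_rot (R : realType) (c s : R) (p : plane R) :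
  toC (rot c s p) = (c +i* s) * (toC p : R[i]) :> R[i].
Proof. by case: p => x y; rewrite /toC /rot /=; simpc; congr (_ +i* _); ring. Qed.

Lemma bweight_rot (R : realType) (alpha c s : R) (p : plane R) : c ^+ 2 + s ^+ 2 = 1 ->
  bweight alpha (rot c s p) = bweight alpha p.
Proof.
move=> cs; rewrite /bweight /rot /=.
have -> : (c * p.1 - s * p.2) ^+ 2 + (s * p.1 + c * p.2) ^+ 2 =
  (c ^+ 2 + s ^+ 2) * (p.1 ^+ 2 + p.2 ^+ 2) by ring.
by rewrite cs mul1r.
Qed.

Lemma cI_rot (R : realType) (alpha c s rho : R) (F : plane R -> R[i]) :
  c ^+ 2 + s ^+ 2 = 1 -> c != -1 -> cmeas (disco rho) F ->
  cI alpha (disco rho) (fun p => F (rot c s p)) = cI alpha (disco rho) F.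
Proof.
move=> cs c1 [F1 F2]; rewrite /cI; congr (_ +i* _); rewrite /Rintegral; congr fine.
  rewrite -[RHS](integral_disco_rot cs c1); last first.
    by apply/measurable_EFinP; apply: measurable_funM => //; exact: measurable_bweight.
  by apply: eq_integral => p _; rewrite bweight_rot.
rewrite -[RHS](integral_disco_rot cs c1); last first.
  by apply/measurable_EFinP; apply: measurable_funM => //; exact: measurable_bweight.
by apply: eq_integral => p _; rewrite bweight_rot.
Qed.

(** * Orthogonality and moments of the monomials *)

Lemma cisD (R : realType) (s t : R) : cis (s + t) = cis s * cis t.
Proof. by rewrite /cis cosD sinD; simpc; congr (_ +i* _); ring. Qed.

Lemma cisX (R : realType) (t : R) n : cis t ^+ n = cis (t *+ n).
Proof.
elim: n => [|n IH]; first by rewrite expr0 mulr0n /cis cos0 sin0.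
by rewrite exprS mulrS cisD IH.
Qed.

Lemma conj_cis (R : realType) (t : R) : conjc (cis t) = (cis t)^-1.
Proof.
apply: (mulfI (cis_neq0 t)); rewrite mulcJ_sqmod divff ?cis_neq0//.
by rewrite /sqmod /= cos2Dsin2.
Qed.

Definition mono (R : realType) (j k : nat) (p : plane R) : R[i] :=
  (toC p : R[i]) ^+ j * conjc ((toC p : R[i]) ^+ k).

Lemma cmeas_mono (R : realType) (E : set (plane R)) j k : cmeas E (@mono R j k).
Proof.
by apply: cmeasM; [|apply: cmeasJ]; apply: cmeasX; exact: cmeas_toC.
Qed.

Lemma mono_le1 (R : realType) j k (p : plane R) : discR R p -> normc (mono j k p) <= 1.
Proof.
rewrite discRE => /(normc_toC_lt ler01) h.
rewrite Normc.normcM normcJ !normc_X mulr_ile1 ?exprn_ge0 ?normc_ge0//;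
  by rewrite exprn_ile1 ?normc_ge0// ltW.
Qed.

Lemma wint_bounded (R : realType) (alpha : R) (E : set (plane R)) (F : plane R -> R[i]) (M : R) :
  -1 < alpha -> measurable E -> E `<=` discR R -> cmeas E F ->
  (forall p, E p -> normc (F p) <= M) -> wint alpha E F.
Proof.
move=> ha mE ED mF FM.
exact: (wint_dom mE mF (integrable_bweight M ha mE ED)).
Qed.

Lemma wint_mono (R : realType) (alpha : R) (E : set (plane R)) j k :
  -1 < alpha -> measurable E -> E `<=` discR R -> wint alpha E (@mono R j k).
Proof.
move=> ha mE ED; apply: (@wint_bounded _ _ _ _ 1) => //; first exact: cmeas_mono.
by move=> p /ED; exact: mono_le1.
Qed.

(** Rotating by [t] multiplies the integrand by [cis t ^+ j * conjc (cis t ^+ k)] and preserves the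
    integral, which is 0 once this factor differs from 1. The angle makes the factor ['i] or [- 'i];
    aiming at -1 instead would require, for exponents differing by 1, the half-turn that [cI_rot]
    excludes. *)
Lemma cI_mono_neq (R : realType) (alpha rho : R) j k :
  -1 < alpha -> 0 <= rho <= 1 -> j != k -> cI alpha (disco rho) (@mono R j k) = 0.
Proof.
move=> ha r01 jk.
have md := @measurable_disco R rho.
have dD : disco rho `<=` discR R by rewrite discRE; exact: disco_disc.
(* [cis t] is a root of unity separating the two exponents *)
pose m := (maxn j k - minn j k)%N.
have m0 : (0 < m)%N.
  rewrite /m subn_gt0; move: jk; rewrite neq_ltn => /orP[h|h].
    by rewrite (maxn_idPr (ltnW h)) (minn_idPl (ltnW h)).
  by rewrite (maxn_idPl (ltnW h)) (minn_idPr (ltnW h)).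
pose t : R := pi / 2 / m%:R.
have tm : cis t ^+ m = 'i.
  rewrite cisX -mulr_natr /t divfK ?pnatr_eq0 -?lt0n//.
  by rewrite /cis cos_pihalf sin_pihalf.
have ci : 'i != 1 :> R[i] by apply/eqP => -[/eqP]; rewrite eq_sym oner_eq0.
have zjk : cis t ^+ j * conjc (cis t ^+ k) != 1.
  rewrite conjcX conj_cis exprVn; apply/eqP => h.
  have {}h : cis t ^+ j = cis t ^+ k.
    by rewrite -[RHS]mul1r -h divfK// expf_neq0// cis_neq0.
  have : cis t ^+ maxn j k = cis t ^+ minn j k by rewrite /maxn /minn; case: ifP.
  rewrite -(subnK (leq_trans (geq_minl j k) (leq_maxl j k))) -/m exprD tm.
  rewrite -[RHS]mul1r => /mulIf; rewrite expf_neq0 ?cis_neq0// => /(_ isT)/eqP.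
  by rewrite (negPf ci).
(* If [cos t] were -1, then [cis t] would be -1 and its powers real, whereas its [m]-th power is
   ['i]. *)
have c1 : cos t != -1.
  apply/eqP => c1; have s0 : sin t = 0.
    by have := cos2Dsin2 t; rewrite c1 sqrrN expr1n -[RHS]addr0 => /addrI/eqP;
      rewrite expf_eq0/= => /eqP.
  have : 'i = (-1) ^+ m :> R[i].
    by rewrite -tm /cis c1 s0 -[-1 in RHS](rmorphN1 (real_complex R)).
  rewrite -signr_odd; case: (odd m); rewrite ?expr1 ?expr0 => -[/eqP];
    rewrite ?eqr_oppLR eq_sym ?oppr_eq0 oner_eq0//.
have := cI_rot alpha (cos2Dsin2 t) c1 (cmeas_mono (disco rho) j k).
have -> : (fun p : plane R => mono j k (rot (cos t) (sin t) p)) =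
   (fun p => cis t ^+ j * conjc (cis t ^+ k) * mono j k p).
  apply/funext => p; rewrite /mono toC_rot -/(cis t) !exprMn conjcM.
  by rewrite -!mulrA; congr (_ * _); rewrite mulrCA.
rewrite cIZ//; last exact: wint_mono.
move=> /eqP; rewrite -subr_eq0 -{2}[cI _ _ _]mul1r -mulrBl mulf_eq0 subr_eq0.
by rewrite (negPf zjk) /= => /eqP.
Qed.

Lemma sqmodX (R : realType) (z : R[i]) k : sqmod (z ^+ k) = sqmod z ^+ k.
Proof. by rewrite !sqmodE normc_X -!exprM mulnC. Qed.

Lemma sqmod_ge0 (R : realType) (z : R[i]) : 0 <= sqmod z.
Proof. by rewrite sqmodE sqr_ge0. Qed.

Lemma wintD (R : realType) (alpha : R) (E : set (plane R)) (F G : plane R -> R[i]) :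
  measurable E -> wint alpha E F -> wint alpha E G -> wint alpha E (fun p => F p + G p).
Proof.
move=> mE [F1 F2] [G1 G2]; split.
  have := integrable_EFinD mE F1 G1; congr (_.-integrable _ (EFin \o _)).
  by apply/funext => p; rewrite ReD mulrDl.
have := integrable_EFinD mE F2 G2; congr (_.-integrable _ (EFin \o _)).
by apply/funext => p; rewrite ImD mulrDl.
Qed.

Lemma cI_sum (R : realType) (alpha : R) (E : set (plane R)) (F : nat -> plane R -> R[i]) n :
  -1 < alpha -> measurable E -> E `<=` discR R -> (forall k, wint alpha E (F k)) ->
  wint alpha E (fun p => \sum_(k < n) F k p) /\
  cI alpha E (fun p => \sum_(k < n) F k p) = \sum_(k < n) cI alpha E (F k).
Proof.
move=> ha mE ED wF; elim: n => [|n [IHw IHe]].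
  have -> : (fun p : plane R => \sum_(k < 0) F k p) = fun=> 0.
    by apply/funext => p; rewrite big_ord0.
  have w0 : wint alpha E (fun=> 0).
    apply: (@wint_bounded _ _ _ _ 0 ha mE ED (cmeas_cst _ _)).
    by move=> p _; rewrite Normc.normc0.
  split=> //; rewrite big_ord0.
  by have := cIZ 0 mE w0; rewrite !mul0r.
have -> : (fun p : plane R => \sum_(k < n.+1) F k p) =
    fun p => (\sum_(k < n) F k p) + F n p.
  by apply/funext => p; rewrite big_ord_recr.
by rewrite big_ord_recr /= -IHe; split; [exact: wintD|exact: cID].
Qed.

(** The squared norm of [z ^+ k] over [E]. *)
Definition moment (R : realType) (alpha : R) (E : set (plane R)) (k : nat) : R :=
  \int[area R]_(p in E) (sqmod ((toC p : R[i]) ^+ k) * bweight alpha p).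

Lemma moment_ge0 (R : realType) (alpha : R) (E : set (plane R)) k : 0 <= moment alpha E k.
Proof.
by apply: Rintegral_ge0 => p _; rewrite mulr_ge0 ?bweight_ge0 ?sqmod_ge0.
Qed.

Lemma cI_real (R : realType) (alpha : R) (E : set (plane R)) (f : plane R -> R) :
  cI alpha E (fun p => (f p)%:C) = (\int[area R]_(p in E) (f p * bweight alpha p))%:C.
Proof.
rewrite /cI /=; congr (_ +i* _); rewrite /Rintegral.
under eq_integral do rewrite mul0r.
by rewrite integral0.
Qed.

Lemma cI_mono_eq (R : realType) (alpha : R) (E : set (plane R)) k :
  cI alpha E (@mono R k k) = (moment alpha E k)%:C.
Proof. by rewrite -cI_real; apply: eq_cI => p _; rewrite /mono mulcJ_sqmod. Qed.

(** The square with sides [[rho / 4, rho / 2]] lies in the disc, away from both 0 and the unit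
    circle, so [|z|^(2k)] and the weight are bounded below on it. *)
Lemma moment_gt0 (R : realType) (alpha : R) (E : set (plane R)) (rho : R) k :
  -1 < alpha -> 0 < rho <= 1 -> measurable E -> E `<=` discR R -> disco rho `<=` E ->
  0 < moment alpha E k.
Proof.
move=> ha /andP[r0 r1] mE ED rE.
pose I : set (measurableTypeR R) := `[rho / 4, rho / 2]%classic.
have I2 : lebesgue_measure I = (rho / 4)%:E.
  rewrite lebesgue_measure_itv/= lte_fin ifT; last by lra.
  by rewrite -EFinB; congr (_%:E); lra.
have aI : (area R (I `*` I) = ((rho / 4) ^+ 2)%:E)%E.
  rewrite expr2 EFinM -I2; apply: product_measure1E; exact: measurable_itv.
have mB : measurable (I `*` I) by apply: measurableX; exact: measurable_itv.
have BP p : (I `*` I) p -> rho ^+ 2 / 8 <= p.1 ^+ 2 + p.2 ^+ 2 <= rho ^+ 2 / 2.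
  case=> /=; rewrite /I /= !in_itv/= => /andP[h1 h2] /andP[h3 h4].
  by apply/andP; split; nra.
have BE : I `*` I `<=` E.
  move=> p /BP/andP[_ h]; apply: rE; rewrite /disco /=; apply: le_lt_trans h _; nra.
(* On the square [1 - |z|^2] lies in [[1/2, 1]]: its power is at least that of [1/2] when
   [alpha >= 0], and at least 1 when [alpha < 0]. *)
pose c2 := Num.min 1 (2^-1 `^ alpha) / pi.
have pi0 : 0 < pi :> R := pi_gt0 R.
have c20 : 0 < c2 by rewrite divr_gt0// lt_min ltr01 powR_gt0// invr_gt0.
pose c1 := (rho ^+ 2 / 8) ^+ k.
have c10 : 0 < c1 by rewrite exprn_gt0// divr_gt0// exprn_gt0.
have lowB p : (I `*` I) p -> c1 * c2 <= sqmod ((toC p : R[i]) ^+ k) * bweight alpha p.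
  move=> /BP/andP[h1 h2]; apply: ler_pM; [exact: ltW|exact: ltW| |].
    rewrite sqmodX lerXn2r// nnegrE ?sqmod_ge0//.
    by rewrite divr_ge0// exprn_ge0// ltW.
  rewrite /c2 /bweight ler_pM2r ?invr_gt0//.
  have t0 : 2^-1 <= 1 - (p.1 ^+ 2 + p.2 ^+ 2) by nra.
  have t1 : 1 - (p.1 ^+ 2 + p.2 ^+ 2) <= 1 by rewrite gerBl addr_ge0 ?sqr_ge0.
  have [a0|a0] := leP 0 alpha.
    rewrite ge_min; apply/orP; right.
    have := @ge0_ler_powR R alpha a0 2^-1 (1 - (p.1 ^+ 2 + p.2 ^+ 2)).
    by rewrite !nnegrE; apply => //; lra.
  rewrite ge_min; apply/orP; left.
  apply: (@le_trans _ _ ((1 - (p.1 ^+ 2 + p.2 ^+ 2)) `^ 0)); first by rewrite powRr0.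
  by apply: ger_powR; [apply/andP; split; lra|exact: ltW].
pose f (p : plane R) : R := sqmod ((toC p : R[i]) ^+ k) * bweight alpha p.
have mf (D : set (plane R)) : measurable_fun D (EFin \o f).
  apply/measurable_EFinP; apply: measurable_funM; last exact: measurable_bweight.
  have [m1 m2] := cmeasX k (@cmeas_toC R D).
  by apply: measurable_funD; apply: measurable_funX.
have f0 p : (0 <= (EFin \o f) p)%E.
  by rewrite lee_fin mulr_ge0 ?bweight_ge0 ?sqmod_ge0.
have [wk _] := wint_mono k k ha mE ED.
have fin : (\int[area R]_(p in E) (f p)%:E < +oo)%E.
  have /integrableP[_] := wk; apply: le_lt_trans; rewrite le_eqVlt; apply/orP; left; apply/eqP.
  apply: eq_integral => p _ /=; rewrite /mono mulcJ_sqmod /= ger0_norm//.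
  by rewrite mulr_ge0 ?bweight_ge0 ?sqmod_ge0.
rewrite /moment /Rintegral; apply: fine_gt0; rewrite fin andbT.
apply: (@lt_le_trans _ _ ((c1 * c2)%:E * area R (I `*` I))%E).
  rewrite aI -EFinM lte_fin; apply: mulr_gt0; first exact: mulr_gt0.
  by apply: exprn_gt0; exact: divr_gt0.
apply: le_trans (ge0_subset_integral (area R) mB mE (mf E) (fun p _ => f0 p) BE).
have <- : (\int[area R]_(p in I `*` I) (cst (c1 * c2)%:E p) =
  (c1 * c2)%:E * area R (I `*` I))%E by exact: integral_cst.
apply: (@ge0_le_integral _ _ _ (area R) _ mB _ _ _ (measurable_cst _) (mf _)).
  by move=> p _; rewrite lee_fin mulr_ge0 ?ltW.
by move=> p Bp; rewrite lee_fin lowB.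
Qed.

(** * Pairings of functions with geometrically convergent expansions *)

(** The case [n = 0], with an empty sum, makes [C] a bound for [F], so one constant controls both
    size and error. *)
Definition approx (R : realType) (rho : R) (F : R[i] -> R[i]) (a : nat -> R[i]) (C q : R) :=
  [/\ 0 <= C, 0 <= q < 1 & forall n (w : R[i]), normc w <= rho ->
      normc (F w - \sum_(k < n) a k * w ^+ k) <= C * q ^+ n].

Lemma approxS (R : realType) (rho rho' : R) F a C q :
  rho' <= rho -> approx rho F a C q -> approx rho' F a C q.
Proof. by move=> rr [C0 q01 H]; split=> // n w h; apply: H; exact: le_trans rr. Qed.

Lemma approx_bound (R : realType) (rho : R) F a C q (w : R[i]) :
  approx rho F a C q -> normc w <= rho -> normc (F w) <= C.
Proof. by move=> [_ _ H] /(H 0); rewrite big_ord0 subr0 expr0 mulr1. Qed.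

Lemma approx_poly_bound (R : realType) (rho : R) F a C q (w : R[i]) n :
  approx rho F a C q -> normc w <= rho -> normc (\sum_(k < n) a k * w ^+ k) <= 2 * C.
Proof.
move=> HA wr; have hF := approx_bound HA wr; move: HA => [C0 /andP[q0 q1] /(_ n w wr)].
rewrite normcBC => h; set P := \sum_(k < n) _ in h *.
rewrite -(subrK (F w) P); apply: le_trans (ler_normcD _ _) _.
have : C * q ^+ n <= C by rewrite ler_piMr// exprn_ile1// ltW.
lra.
Qed.

Lemma approxZ (R : realType) (rho : R) F a C q (c : R[i]) :
  approx rho F a C q -> approx rho (fun z => c * F z) (fun k => c * a k) (normc c * C) q.
Proof.
move=> [C0 q01 H]; split=> //; first by rewrite mulr_ge0 ?normc_ge0.
move=> n w wr; under eq_bigr do rewrite -mulrA.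
by rewrite -mulr_sumr -mulrBr Normc.normcM -mulrA ler_wpM2l ?normc_ge0// H.
Qed.

Lemma approx_dilate (R : realType) (rho : R) F a C q (d : R[i]) :
  normc d <= 1 -> approx rho F a C q ->
  approx rho (fun z => F (d * z)) (fun k => a k * d ^+ k) C q.
Proof.
move=> d1 [C0 q01 H]; split=> // n w wr.
have := H n (d * w); under eq_bigr do rewrite exprMn mulrA.
apply; rewrite Normc.normcM; apply: le_trans wr.
by rewrite ler_piMl ?normc_ge0.
Qed.

(** The error vanishes once [n > k]; for [n <= k] the monomial is not yet in the sum, and [2 ^+ k]
    absorbs its size. *)
Lemma approx_mono (R : realType) (rho : R) k : rho <= 1 ->
  approx rho (fun z : R[i] => z ^+ k) (fun j => (j == k)%:R) (2 ^+ k) 2^-1.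
Proof.
move=> r1; split; first by rewrite exprn_ge0.
  by apply/andP; split; lra.
move=> n w wr; have [kn|nk] := ltnP k n.
  rewrite (bigD1 (Ordinal kn))//= eqxx mul1r big1 ?addr0 ?subrr ?Normc.normc0.
    by rewrite mulr_ge0 ?exprn_ge0 ?invr_ge0.
  move=> i /negPf ik; rewrite (_ : (i == k :> nat) = false) ?mul0r//.
rewrite big1 ?subr0 => [|i _]; last first.
  by rewrite ltn_eqF ?mul0r// (leq_trans (ltn_ord i)).
have -> : 2 ^+ k * 2^-1 ^+ n = 2 ^+ (k - n) :> R.
  by rewrite exprVn -{1}(subnK nk) exprD mulfK// expf_neq0// pnatr_eq0.
rewrite normc_X.
apply: (@le_trans _ _ 1).
  by rewrite exprn_ile1 ?normc_ge0// (le_trans wr).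
by rewrite exprn_ege1// ler1n.
Qed.

Lemma approx_cmeas (R : realType) (rho : R) F a C q :
  0 <= rho -> approx rho F a C q -> cmeas (disco rho) (fun p => F (toC p)).
Proof.
move=> r0 [C0 /andP[q0 q1] H].
have cv : C * q ^+ n @[n --> \oo] --> (0 : R).
  by apply: cvg_geometric; rewrite ger0_norm.
have lim (part : R[i] -> R) (p : plane R) : (forall x y, `|part x - part y| <= normc (x - y)) ->
    disco rho p ->
    part (\sum_(k < n) a k * (toC p : R[i]) ^+ k) @[n --> \oo] --> part (F (toC p)).
  move=> hp /(normc_toC_lt r0)/ltW wr; apply/cvgrPdist_le => e e0.
  move/cvgrPdist_le : cv => /(_ e e0); apply: filterS => n.
  rewrite sub0r normrN => h; apply: le_trans (hp _ _) _.
  by apply: le_trans (H n _ wr) _; apply: le_trans h; exact: ler_norm.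
split.
  apply: (measurable_fun_cvg (h := fun n p =>
    complex.Re (\sum_(k < n) a k * (toC p : R[i]) ^+ k))).
    by move=> n; case: (cmeas_poly (disco rho) a n).
  move=> p; apply: lim => x y; apply: le_trans (normc_Re _).
  by case: x y => [? ?] [? ?].
apply: (measurable_fun_cvg (h := fun n p =>
  complex.Im (\sum_(k < n) a k * (toC p : R[i]) ^+ k))).
  by move=> n; case: (cmeas_poly (disco rho) a n).
move=> p; apply: lim => x y; apply: le_trans (normc_Im _).
by case: x y => [? ?] [? ?].
Qed.

Lemma cI_poly (R : realType) (alpha rho : R) (a b : nat -> R[i]) n :
  -1 < alpha -> 0 <= rho <= 1 ->
  cI alpha (disco rho) (fun p => (\sum_(k < n) a k * (toC p : R[i]) ^+ k) *
     conjc (\sum_(k < n) b k * (toC p : R[i]) ^+ k)) =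
  \sum_(k < n) a k * conjc (b k) * (moment alpha (disco rho) k)%:C.
Proof.
move=> ha r01; have md := @measurable_disco R rho.
have dD : disco rho `<=` discR R by rewrite discRE; exact: disco_disc.
have wjk j k : wint alpha (disco rho) (fun p => a j * conjc (b k) * mono j k p).
  by apply: wintZ => //; exact: wint_mono.
have -> : (fun p : plane R => (\sum_(k < n) a k * (toC p : R[i]) ^+ k) *
     conjc (\sum_(k < n) b k * (toC p : R[i]) ^+ k)) =
    (fun p => \sum_(j < n) \sum_(k < n) a j * conjc (b k) * mono j k p).
  apply/funext => p; rewrite (conjc_sum n (fun k => b k * (toC p : R[i]) ^+ k)).
  rewrite big_distrl /=; apply: eq_bigr => j _; rewrite big_distrr /=.
  by apply: eq_bigr => k _; rewrite conjcM /mono; ring.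
have [_ ->] := @cI_sum R alpha (disco rho)
  (fun j p => \sum_(k < n) a j * conjc (b k) * mono j k p) n ha md dD
  (fun j => (@cI_sum R alpha (disco rho) (fun k p => a j * conjc (b k) * mono j k p) n
     ha md dD (wjk j)).1).
apply: eq_bigr => j _.
have [_ ->] := @cI_sum R alpha (disco rho) (fun k p => a j * conjc (b k) * mono j k p) n
  ha md dD (wjk j).
rewrite (bigD1 j)//= cIZ ?cI_mono_eq//; last exact: wint_mono.
rewrite big1 ?addr0// => k kj; rewrite cIZ//; last exact: wint_mono.
by rewrite cI_mono_neq ?mulr0// eq_sym.
Qed.

(** Parseval's formula in finite form: the partial sums are paired exactly by orthogonality, and
    replacing one factor at a time bounds the rest. *)
Lemma pairing_bound (R : realType) (alpha rho : R) F G a b C C' q q' :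
  -1 < alpha -> 0 <= rho <= 1 -> approx rho F a C q -> approx rho G b C' q' ->
  exists K Q, [/\ 0 <= K, 0 <= Q < 1 & forall n,
    normc (cI alpha (disco rho) (fun p => F (toC p) * conjc (G (toC p))) -
      \sum_(k < n) a k * conjc (b k) * (moment alpha (disco rho) k)%:C) <= K * Q ^+ n].
Proof.
move=> ha r01 HF HG; have md := @measurable_disco R rho.
have /andP[r0 r1] := r01.
have dD : disco rho `<=` discR R by rewrite discRE; exact: disco_disc.
have mF := approx_cmeas r0 HF; have mG := approx_cmeas r0 HG.
have [C0 /andP[q0 q1] hF] := HF; have [C'0 /andP[q'0 q'1] hG] := HG.
(* Replacing [F] costs [C * C']. Replacing [G] costs [2 * C * C'], since the partial sum that then
   stands in for [F] is bounded by [2 * C]. *)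
pose Q := Num.max q q'; pose M := 3 * C * C'.
pose W := \int[area R]_(p in disco rho) (1 * bweight alpha p).
have W0 : 0 <= W by apply: Rintegral_ge0 => p _; rewrite mul1r bweight_ge0.
have M0 : 0 <= M by rewrite !mulr_ge0.
exists (2 * (M * W)), Q; split.
- by rewrite !mulr_ge0.
- by rewrite /Q le_max q0 gt_max q1 q'1.
move=> n; pose P (p : plane R) : R[i] := \sum_(k < n) a k * (toC p : R[i]) ^+ k.
pose P' (p : plane R) : R[i] := \sum_(k < n) b k * (toC p : R[i]) ^+ k.
have mP : cmeas (disco rho) P := cmeas_poly _ _ _.
have mP' : cmeas (disco rho) P' := cmeas_poly _ _ _.
have wFG : wint alpha (disco rho) (fun p => F (toC p) * conjc (G (toC p))).
  apply: (@wint_bounded _ _ _ _ (C * C')) => //; first by apply: cmeasM => //; exact: cmeasJ.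
  move=> p /(normc_toC_lt r0)/ltW wr; rewrite Normc.normcM normcJ.
  by apply: ler_pM; rewrite ?normc_ge0 ?(approx_bound HF wr) ?(approx_bound HG wr).
have wPP : wint alpha (disco rho) (fun p => P p * conjc (P' p)).
  apply: (@wint_bounded _ _ _ _ ((2 * C) * (2 * C'))) => //.
    by apply: cmeasM => //; exact: cmeasJ.
  move=> p /(normc_toC_lt r0)/ltW wr; rewrite Normc.normcM normcJ.
  by apply: ler_pM; rewrite ?normc_ge0 ?(approx_poly_bound _ HF wr) ?(approx_poly_bound _ HG wr).
rewrite -cI_poly// -[X in _ - X]mul1r -mulNr -cIZ// -cID//; last exact: wintZ.
have mD : cmeas (disco rho) (fun p => F (toC p) * conjc (G (toC p)) + -1 * (P p * conjc (P' p))).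
  apply: cmeasD; first by apply: cmeasM => //; exact: cmeasJ.
  by apply: cmeasM (cmeas_cst _ _) _; apply: cmeasM => //; exact: cmeasJ.
have iH := integrable_bweight (M * Q ^+ n) ha md dD.
apply: le_trans (normc_cI md mD iH _) _; last first.
  have -> : \int[area R]_(p in disco rho) (M * Q ^+ n * bweight alpha p) = M * Q ^+ n * W.
    rewrite -RintegralZl//; last exact: integrable_bweight.
    by apply: eq_Rintegral => p _; rewrite mul1r.
  by rewrite le_eqVlt; apply/orP; left; apply/eqP; ring.
move=> p /(normc_toC_lt r0)/ltW wr.
have -> : F (toC p) * conjc (G (toC p)) + -1 * (P p * conjc (P' p)) =
   (F (toC p) - P p) * conjc (G (toC p)) + P p * conjc (G (toC p) - P' p).
  by rewrite conjcB; ring.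
have b1 := hF n _ wr; have b2 := hG n _ wr.
have b3 := approx_bound HG wr; have b4 := approx_poly_bound n HF wr.
have qQ : q ^+ n <= Q ^+ n by rewrite lerXn2r ?nnegrE ?le_max ?q0 ?lexx.
have q'Q : q' ^+ n <= Q ^+ n by rewrite lerXn2r ?nnegrE ?le_max ?q0 ?lexx ?orbT.
apply: le_trans (ler_normcD _ _) _; rewrite !Normc.normcM !normcJ.
apply: (@le_trans _ _ ((C * Q ^+ n) * C' + (2 * C) * (C' * Q ^+ n))); last first.
  by rewrite le_eqVlt; apply/orP; left; apply/eqP; rewrite /M; ring.
apply: lerD; apply: ler_pM; rewrite ?normc_ge0//.
  by apply: le_trans b1 _; rewrite ler_wpM2l.
by apply: le_trans b2 _; rewrite ler_wpM2l.
Qed.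

Lemma le_geometric (R : realType) (x y K Q : R) : 0 <= K -> 0 <= Q < 1 ->
  (forall n, x <= y + K * Q ^+ n) -> x <= y.
Proof.
move=> K0 /andP[Q0 Q1] H; apply/ler_addgt0Pr => e e0.
have := @cvg_geometric R K Q; rewrite ger0_norm// => /(_ Q1)/cvgrPdist_le/(_ e e0).
move=> [N _ /(_ N (leqnn _))]; rewrite sub0r normrN /= => HN.
apply: le_trans (H N) _; rewrite lerD2l; apply: le_trans HN; exact: ler_norm.
Qed.

(** Both pairings are limits of the same partial sums. This is how a factor is moved from one
    argument to the other. *)
Lemma pairing_eq (R : realType) (alpha rho : R) F G F' G' a b a' b' C C' q q' D D' s s' :
  -1 < alpha -> 0 <= rho <= 1 -> approx rho F a C q -> approx rho G b C' q' ->
  approx rho F' a' D s -> approx rho G' b' D' s' ->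
  (forall k, a k * conjc (b k) = a' k * conjc (b' k)) ->
  cI alpha (disco rho) (fun p => F (toC p) * conjc (G (toC p))) =
  cI alpha (disco rho) (fun p => F' (toC p) * conjc (G' (toC p))).
Proof.
move=> ha r01 HF HG HF' HG' ab.
have [K [Q [K0 /andP[Q0 Q1] H]]] := pairing_bound ha r01 HF HG.
have [K' [Q' [K'0 /andP[Q'0 Q'1] H']]] := pairing_bound ha r01 HF' HG'.
apply/eqP; rewrite -subr_eq0; apply/eqP.
apply: (@normc_eq0_geometric _ _ (K + K') (Num.max Q Q')); first exact: addr_ge0.
  by rewrite le_max Q0 gt_max Q1 Q'1.
move=> n; have := H n; have := H' n; under [in X in X -> _]eq_bigr do rewrite -ab.
set x := cI _ _ _; set y := cI _ _ _; set S := \sum_(k < n) _ => h h'.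
rewrite (_ : y - x = (y - S) - (x - S)); last by ring.
apply: le_trans (ler_normcD _ _) _; rewrite normcNE mulrDl; apply: lerD.
  apply: le_trans h' _; rewrite ler_wpM2l//.
  by rewrite lerXn2r ?nnegrE ?le_max ?Q0 ?lexx.
apply: le_trans h _; rewrite ler_wpM2l//.
by rewrite lerXn2r ?nnegrE ?le_max ?Q0 ?lexx ?orbT.
Qed.

(** Against the coefficients of [z ^+ k] the sequences of [F] and of [a k * z ^+ k] have the same
    products, so [F] can be replaced by its [k]-th term. *)
Lemma pairing_coef (R : realType) (alpha rho : R) F a C q k :
  -1 < alpha -> 0 <= rho <= 1 -> approx rho F a C q ->
  cI alpha (disco rho) (fun p => F (toC p) * conjc ((toC p : R[i]) ^+ k)) =
  a k * (moment alpha (disco rho) k)%:C.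
Proof.
move=> ha r01 HF; have /andP[_ r1] := r01.
have dD : disco rho `<=` discR R by rewrite discRE; exact: disco_disc.
have Hk := @approx_mono R rho k r1.
rewrite (pairing_eq ha r01 HF Hk (approxZ (a k) Hk) Hk).
  rewrite -cI_mono_eq -cIZ; [|exact: measurable_disco|]; last first.
    by apply: wint_mono => //; exact: measurable_disco.
  by apply: eq_cI => p _; rewrite /mono mulrA.
by move=> j; have [->|_] := eqVneq j k; rewrite ?mulr1// conjc0 !mulr0.
Qed.

Lemma disco_contract (R : realType) (alpha rho : R) F F' a a' C C' q q' :
  -1 < alpha -> 0 <= rho <= 1 -> approx rho F a C q -> approx rho F' a' C' q' ->
  (forall k, normc (a' k) <= normc (a k)) ->
  \int[area R]_(p in disco rho) (sqmod (F' (toC p)) * bweight alpha p) <=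
  \int[area R]_(p in disco rho) (sqmod (F (toC p)) * bweight alpha p).
Proof.
move=> ha r01 HF HF' aa.
have [K [Q [K0 /andP[Q0 Q1] H]]] := pairing_bound ha r01 HF HF.
have [K' [Q' [K'0 /andP[Q'0 Q'1] H']]] := pairing_bound ha r01 HF' HF'.
have sq G : cI alpha (disco rho) (fun p => G (toC p) * conjc (G (toC p))) =
    (\int[area R]_(p in disco rho) (sqmod (G (toC p) : R[i]) * bweight alpha p))%:C.
  by rewrite -cI_real; apply: eq_cI => p _; rewrite mulcJ_sqmod.
rewrite !sq in H H'.
have sumE (c : nat -> R[i]) n : \sum_(k < n) c k * conjc (c k) * (moment alpha (disco rho) k)%:C =
   (\sum_(k < n) sqmod (c k) * moment alpha (disco rho) k)%:C.
  by rewrite rmorph_sum; apply: eq_bigr => k _; rewrite mulcJ_sqmod rmorphM.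
apply: (@le_geometric _ _ _ (K + K') (Num.max Q Q')); first exact: addr_ge0.
  by rewrite le_max Q0 gt_max Q1 Q'1.
move=> n; have := H n; have := H' n; rewrite !sumE -!rmorphB !normc_real.
set x := \int[_]_(_ in _) _; set y := \int[_]_(_ in _) _.
set S' := \sum_(k < n) _; set S := \sum_(k < n) _.
have SS : S' <= S.
  apply: ler_sum => k _; rewrite ler_wpM2r ?moment_ge0// !sqmodE.
  by rewrite lerXn2r ?nnegrE ?normc_ge0.
have q1 : K * Q ^+ n <= K * Num.max Q Q' ^+ n.
  by rewrite ler_wpM2l// lerXn2r ?nnegrE ?le_max ?Q0 ?lexx.
have q2 : K' * Q' ^+ n <= K' * Num.max Q Q' ^+ n.
  by rewrite ler_wpM2l// lerXn2r ?nnegrE ?le_max ?Q0 ?lexx ?orbT.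
rewrite !ler_norml => /andP[h1 h2] /andP[h3 h4]; rewrite mulrDl; lra.
Qed.

(** Pairing with [z ^+ k] on the disc of radius [1/2] determines the [k]-th coefficient, the moment
    there being positive. Hence the coefficients found for a larger radius are those found for
    [1/2]. The auxiliary weight is the one with [alpha = 0]. *)
Lemma taylor (R : realType) (f : CC R -> CC R) : holo_disc f ->
  exists a : nat -> R[i], forall rho, 0 <= rho < 1 -> exists C q, approx rho f a C q.
Proof.
move=> hf; have h2 : 0 <= (2^-1 : R) < 1 by apply/andP; split; lra.
have [a [C [q Ha]]] := taylor_approx hf h2.
exists a => rho /andP[r0 r1]; pose r := Num.max rho 2^-1.
have r01 : 0 <= r < 1 by rewrite le_max r0 gt_max r1; case/andP: h2.
have [b [C' [q' Hb]]] := taylor_approx hf r01.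
suff -> : a = b by exists C', q'; apply: approxS Hb; rewrite le_max lexx.
apply/funext => k; have h01 : 0 <= (2^-1 : R) <= 1 by apply/andP; split; lra.
have Hb' : approx 2^-1 f b C' q' by apply: approxS Hb; rewrite le_max lexx orbT.
have a0 : -1 < (0 : R) by [].
have := pairing_coef k a0 h01 Ha; rewrite (pairing_coef k a0 h01 Hb') => /mulIf -> //.
apply/eqP => -[] /eqP; rewrite gt_eqF//.
apply: (@moment_gt0 _ _ _ 2^-1) => //; first by apply/andP; split; lra.
  exact: measurable_disco.
by rewrite discRE; exact: disco_disc.
Qed.

Lemma approx_at0 (R : realType) (rho : R) F a C q :
  0 <= rho -> approx rho F a C q -> a 0 = F 0.
Proof.
move=> r0 [C0 q01 H]; apply/eqP; rewrite eq_sym -subr_eq0; apply/eqP.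
apply: (@normc_eq0_geometric _ _ (C * q) q) => //.
  by apply: mulr_ge0 => //; case/andP: q01.
move=> n; have := H n.+1 0; rewrite Normc.normc0 => /(_ r0).
rewrite big_ord_recl expr0 mulr1 big1 ?addr0 => [|k _]; last by rewrite expr0n mulr0.
by rewrite exprS mulrA.
Qed.

(** * Exhaustion of the unit disc *)

(** With [n.+2] the first radius is already positive, namely [1/2]. *)
Definition rad (R : realType) (n : nat) : R := 1 - n.+2%:R^-1.

Lemma rad01 (R : realType) n : 0 < rad R n < 1.
Proof.
rewrite /rad; apply/andP; split; last by rewrite gtrBl invr_gt0 ltr0n.
by rewrite subr_gt0 invf_lt1 ?ltr0n// ltr1n.
Qed.

Lemma disco_rad_nd (R : realType) m n : (m <= n)%N -> disco (rad R m) `<=` disco (rad R n).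
Proof.
move=> mn p; rewrite /disco /= => /lt_le_trans; apply.
have /andP[h1 _] := rad01 R m; have /andP[h2 _] := rad01 R n.
rewrite lerXn2r ?nnegrE ?(ltW h1) ?(ltW h2)// /rad lerB// lef_pV2 ?posrE ?ltr0n//.
by rewrite ler_nat.
Qed.

Lemma bigcup_disco_rad (R : realType) : \bigcup_n disco (rad R n) = discR R.
Proof.
apply/seteqP; split=> p.
  move=> [n _ h]; rewrite discRE; apply: disco_disc h.
  by have /andP[h1 h2] := rad01 R n; rewrite !ltW.
rewrite discRE => /(normc_toC_lt ler01) h.
have [n hn] : exists n, normc (toC p : R[i]) < rad R n.
  have d0 : 0 < 1 - normc (toC p : R[i]) by rewrite subr_gt0.
  have [n _ hn] := near_infty_natSinv_lt (PosNum d0).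
  exists n; have := hn n (leqnn _) => /= h'; rewrite /rad ltrBrDr addrC -ltrBrDr.
  apply: le_lt_trans h'; rewrite lef_pV2 ?posrE ?ltr0n// ler_nat//.
by exists n => //; exact: disco_normc_lt.
Qed.

(** As [h] may change sign, the limit is taken by dominated convergence, with [|h|] dominating its
    truncations. *)
Lemma Rintegral_exhaust_eq0 (R : realType) (h : plane R -> R) :
  (area R).-integrable (discR R) (EFin \o h) ->
  (forall rho, 0 < rho < 1 -> \int[area R]_(p in disco rho) h p = 0) ->
  \int[area R]_(p in discR R) h p = 0.
Proof.
move=> ih H; pose hn n := (EFin \o h) \_ (disco (rad R n)).
have mD := @measurable_discR R.
have sub n : disco (rad R n) `<=` discR R.
  by rewrite -bigcup_disco_rad => p hp; exists n.
have mh := measurable_int (area R) ih.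
have mhn n : measurable_fun (discR R) (hn n).
  apply: measurable_funTS; apply/(measurable_restrictT _ (measurable_disco _)).
  exact: (measurable_funS mD (@sub n) mh).
have cv (p : plane R) : discR R p -> hn n p @[n --> \oo] --> (EFin \o h) p.
  rewrite -bigcup_disco_rad => -[N _ hN]; apply: cvg_near_cst; near=> n.
  rewrite /hn patchE mem_set//; apply: disco_rad_nd hN; near: n; exact: nbhs_infty_ge.
have dom (p : plane R) : forall n, discR R p -> (`|hn n p| <= (abse \o (EFin \o h)) p)%E.
  by move=> n _; rewrite /hn patchE; case: ifP => // _; rewrite abse0 abse_ge0.
have [_ _] := dominated_convergence mD mhn mh (aeW (area R) cv) (integrable_abse ih)
  (aeW (area R) dom).
have -> : [sequence (\int[area R]_(x in discR R) hn n x)%E]_n = fun=> 0%E.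
  apply/funext => n /=; rewrite /hn -integral_mkcondr setIidr; last exact: sub.
  have in_ : (area R).-integrable (disco (rad R n)) (EFin \o h).
    exact: (integrableS mD (measurable_disco _) (@sub n) ih).
  rewrite -[LHS]fineK; last first.
    by apply: integrable_fin_num => //; exact: measurable_disco.
  by have := H _ (rad01 R n); rewrite /Rintegral => ->.
move=> /cvg_lim; rewrite lim_cst// => /(_ _) E0.
by rewrite /Rintegral -E0.
Unshelve. all: by end_near. Qed.

Lemma cI_exhaust_eq (R : realType) (alpha : R) (F G : plane R -> R[i]) :
  wint alpha (discR R) F -> wint alpha (discR R) G ->
  (forall rho, 0 < rho < 1 -> cI alpha (disco rho) F = cI alpha (disco rho) G) ->
  cI alpha (discR R) F = cI alpha (discR R) G.
Proof.
move=> [F1 F2] [G1 G2] H; have mD := @measurable_discR R.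
have sub rho : 0 < rho < 1 -> disco rho `<=` discR R.
  by move=> /andP[h1 h2]; rewrite discRE; apply: disco_disc; rewrite !ltW.
have key (f g : plane R -> R) : (area R).-integrable (discR R) (EFin \o f) ->
    (area R).-integrable (discR R) (EFin \o g) ->
    (forall rho, 0 < rho < 1 ->
      \int[area R]_(p in disco rho) f p = \int[area R]_(p in disco rho) g p) ->
    \int[area R]_(p in discR R) f p = \int[area R]_(p in discR R) g p.
  move=> f1 g1 fg; apply/eqP; rewrite -subr_eq0 -RintegralB//; apply/eqP.
  apply: Rintegral_exhaust_eq0; first exact: integrable_EFinB.
  move=> rho r01; have md := @measurable_disco R rho.
  rewrite RintegralB//; last 2 first.
  - exact: (integrableS mD md (sub _ r01) f1).
  - exact: (integrableS mD md (sub _ r01) g1).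
  by rewrite fg// subrr.
by rewrite /cI; congr (_ +i* _); apply: key => // rho /H; rewrite /cI => -[].
Qed.

Lemma cI_conj (R : realType) (alpha : R) (E : set (plane R)) (F : plane R -> R[i]) :
  measurable E -> wint alpha E F ->
  cI alpha E (fun p => conjc (F p)) = conjc (cI alpha E F).
Proof.
move=> mE [_ F2]; rewrite /cI /=; congr (_ +i* _).
  by apply: eq_Rintegral => p _; case: (F p).
rewrite -mulN1r -RintegralZl//.
by apply: eq_Rintegral => p _; case: (F p) => ? ? /=; rewrite mulNr mulN1r.
Qed.

Lemma holo_cmeas (R : realType) (f : CC R -> CC R) : holo_disc f ->
  cmeas (discR R) (fun p => f (toC p) : R[i]).
Proof.
move=> hf; have [a Ha] := taylor hf.
have H n : cmeas (disco (rad R n)) (fun p => f (toC p) : R[i]).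
  have /andP[h1 h2] := rad01 R n; have r01 : 0 <= rad R n < 1 by rewrite (ltW h1).
  by have [C [q h]] := Ha _ r01; apply: approx_cmeas h; exact: ltW.
rewrite -bigcup_disco_rad; split.
  by apply/measurable_fun_bigcup => n; [exact: measurable_disco|case: (H n)].
by apply/measurable_fun_bigcup => n; [exact: measurable_disco|case: (H n)].
Qed.

(** * The Bergman space: membership, dilations, coefficients *)

Lemma measurable_sqmod (R : realType) (alpha : R) (E : set (plane R)) (F : plane R -> R[i]) :
  cmeas E F -> measurable_fun E (EFin \o (fun p => sqmod (F p) * bweight alpha p)).
Proof.
move=> [F1 F2]; apply/measurable_EFinP; apply: measurable_funM; last exact: measurable_bweight.
by apply: measurable_funD; exact: measurable_funX.
Qed.

Lemma sqmod_bweight_ge0 (R : realType) (alpha : R) (z : R[i]) (p : plane R) :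
  0 <= sqmod z * bweight alpha p.
Proof. by rewrite mulr_ge0 ?sqmod_ge0 ?bweight_ge0. Qed.

Lemma inA2_integrable (R : realType) (alpha : R) (f : CC R -> CC R) : inA2 alpha f ->
  (area R).-integrable (discR R) (EFin \o (fun p => sqmod (f (toC p)) * bweight alpha p)).
Proof.
move=> [hf fin]; apply/integrableP; split.
  exact: (measurable_sqmod alpha (holo_cmeas hf)).
apply: le_lt_trans fin; rewrite le_eqVlt; apply/orP; left; apply/eqP.
by apply: eq_integral => p _ /=; rewrite ger0_norm// sqmod_bweight_ge0.
Qed.

Lemma inA2_wint (R : realType) (alpha : R) (f g : CC R -> CC R) :
  inA2 alpha f -> inA2 alpha g ->
  wint alpha (discR R) (fun p => f (toC p) * conjc (g (toC p))).
Proof.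
move=> hf hg; have mD := @measurable_discR R.
apply: (wint_dom (H := fun p => sqmod (f (toC p)) + sqmod (g (toC p)))) => //.
- by apply: cmeasM; [|apply: cmeasJ]; apply: holo_cmeas; [case: hf|case: hg].
- have := integrable_EFinD mD (inA2_integrable hf) (inA2_integrable hg).
  congr (_.-integrable _ (EFin \o _)); apply/funext => p.
  exact/esym/mulrDl.
move=> p _; rewrite Normc.normcM normcJ !sqmodE.
have := normc_ge0 (f (toC p) : R[i]); have := normc_ge0 (g (toC p) : R[i]).
by set x := normc _; set y := normc _; nra.
Qed.

Lemma inA2_bounded (R : realType) (alpha : R) (f : CC R -> CC R) :
  -1 < alpha -> holo_disc f -> (forall z : R[i], normc z < 1 -> normc (f z : R[i]) <= 1) ->
  inA2 alpha f.
Proof.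
move=> ha hf f1; split=> //; have mD := @measurable_discR R.
apply: le_lt_trans (bweight_integral_lty ha); rewrite /bnorm2.
apply: (@ge0_le_integral _ _ _ (area R) _ mD).
- by move=> p _; rewrite lee_fin sqmod_bweight_ge0.
- exact: (measurable_sqmod alpha (holo_cmeas hf)).
- by apply/measurable_EFinP; exact: measurable_bweight.
move=> p; rewrite discRE => /(normc_toC_lt ler01)/f1 h.
rewrite lee_fin ler_piMl ?bweight_ge0// sqmodE exprn_ile1// normc_ge0//.
Qed.

(** The dilation multiplies the [k]-th coefficient by [d ^+ k], of modulus at most 1, so it does not
    increase the norm over any smaller disc; monotone convergence does the rest. *)
Lemma inA2_dilate (R : realType) (alpha : R) (f : CC R -> CC R) (d : R[i]) :
  -1 < alpha -> normc d <= 1 -> inA2 alpha f -> inA2 alpha (fun z => f (d * z)).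
Proof.
move=> ha d1 [hf fin]; have mD := @measurable_discR R.
have dz (z : R[i]) : normc z < 1 -> normc (d * z) < 1.
  by move=> z1; rewrite Normc.normcM; apply: le_lt_trans z1; rewrite ler_piMl ?normc_ge0.
have hfd : holo_disc (fun z : CC R => f (d * (z : R[i]))).
  apply/holo_discP => z /dz /((holo_discP f).1 hf)[l hl].
  eexists; apply: (cderiv_comp (g := fun z => d * z) hl).
  exact: cderivM (cderiv_cst d z) (cderiv_id z).
split=> //; apply: le_lt_trans fin; rewrite /bnorm2 -{1}bigcup_disco_rad.
have [a Ha] := taylor hf.
have sub n : disco (rad R n) `<=` discR R.
  by rewrite -bigcup_disco_rad => p hp; exists n.
have md n := @measurable_disco R (rad R n).
have mfd := measurable_sqmod alpha (holo_cmeas hfd).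
have mf := measurable_sqmod alpha (holo_cmeas hf).
apply: (ge0_integral_exhaust_le (@disco_rad_nd R) md) => [n|n p _|n].
- exact: (measurable_funS mD (@sub n) mfd).
- by rewrite lee_fin sqmod_bweight_ge0.
have /andP[r0 r1] := rad01 R n; have r01 : 0 <= rad R n < 1 by rewrite (ltW r0).
have r01' : 0 <= rad R n <= 1 by rewrite !ltW.
have [C [q h]] := Ha _ r01; have hd := approx_dilate d1 h.
have fint F b C' q' : approx (rad R n) F b C' q' ->
   (area R).-integrable (disco (rad R n)) (EFin \o (fun p => sqmod (F (toC p)) * bweight alpha p)).
  move=> hF; have mF := approx_cmeas (ltW r0) hF.
  have [] := @wint_bounded _ alpha _ (fun p => F (toC p) * conjc (F (toC p))) (C' * C') ha
    (md n) (@sub n) (cmeasM mF (cmeasJ mF)).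
    move=> p /(normc_toC_lt (ltW r0))/ltW wr; rewrite Normc.normcM normcJ.
    by apply: ler_pM; rewrite ?normc_ge0 ?(approx_bound hF wr).
  move=> + _; congr (_.-integrable _ (EFin \o _)); apply/funext => p.
  by rewrite mulcJ_sqmod.
apply: (@le_trans _ _ (\int[area R]_(p in disco (rad R n))
  (sqmod (f (toC p)) * bweight alpha p)%:E)%E).
  have i1 := fint _ _ _ _ hd; have i2 := fint _ _ _ _ h.
  have := disco_contract ha r01' h hd; rewrite /Rintegral -lee_fin !fineK.
  - apply => k; rewrite Normc.normcM normc_X ler_piMr ?normc_ge0//.
    by rewrite exprn_ile1// normc_ge0.
  - exact: (integrable_fin_num (md n) i2).
  - exact: (integrable_fin_num (md n) i1).
apply: (ge0_subset_integral (area R) (md n) mD mf _ (@sub n)) => p _.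
by rewrite lee_fin sqmod_bweight_ge0.
Qed.

(** On each smaller disc the products of coefficients coincide: [a k * d ^+ k * conj (b k)] is also
    [a k] times the conjugate of [b k * conj d ^+ k]. *)
Lemma binner_dilate (R : realType) (alpha : R) (f g : CC R -> CC R) (d : R[i]) :
  -1 < alpha -> normc d <= 1 -> inA2 alpha f -> inA2 alpha g ->
  binner alpha (fun z => f (d * z)) g = binner alpha f (fun z => g (conjc d * z)).
Proof.
move=> ha d1 hf hg; have d1' : normc (conjc d) <= 1 by rewrite normcJ.
have fd := inA2_dilate ha d1 hf; have gd := inA2_dilate ha d1' hg.
apply: (cI_exhaust_eq (inA2_wint fd hg) (inA2_wint hf gd)) => rho /andP[r0 r1].
have r01 : 0 <= rho < 1 by rewrite (ltW r0).
have r01' : 0 <= rho <= 1 by rewrite !ltW.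
have [a Ha] := taylor hf.1; have [b Hb] := taylor hg.1.
have [C [q h]] := Ha _ r01; have [C' [q' h']] := Hb _ r01.
apply: (pairing_eq ha r01' (approx_dilate d1 h) h' h (approx_dilate d1' h')) => k.
by rewrite conjcM conjcX conjcK; ring.
Qed.

Lemma binner_coef (R : realType) (alpha : R) (f : CC R -> CC R) (a : nat -> R[i]) k :
  -1 < alpha -> inA2 alpha f ->
  (forall rho, 0 <= rho < 1 -> exists C q, approx rho f a C q) ->
  binner alpha f (fun z => (z : R[i]) ^+ k) = a k * (moment alpha (discR R) k)%:C.
Proof.
move=> ha hf Ha; have mD := @measurable_discR R.
have hk : inA2 alpha (fun z : CC R => (z : R[i]) ^+ k).
  apply: inA2_bounded => //; first by apply/holo_discP => z _; exact: cderivX.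
  by move=> z z1; rewrite normc_X exprn_ile1 ?normc_ge0// ltW.
have wk : wint alpha (discR R) (@mono R k k) by exact: wint_mono.
rewrite -cI_mono_eq -cIZ//.
apply: (cI_exhaust_eq (inA2_wint hf hk) (wintZ _ mD wk)) => rho /andP[r0 r1].
have r01 : 0 <= rho < 1 by rewrite (ltW r0).
have r01' : 0 <= rho <= 1 by rewrite !ltW.
have [C [q h]] := Ha _ r01; rewrite (pairing_coef k ha r01' h) -cI_mono_eq cIZ//.
  exact: measurable_disco.
apply: wint_mono => //; first exact: measurable_disco.
by rewrite discRE; exact: disco_disc.
Qed.

Lemma binnerC (R : realType) (alpha : R) (f g : CC R -> CC R) :
  inA2 alpha f -> inA2 alpha g -> binner alpha g f = conjc (binner alpha f g).
Proof.
move=> hf hg; have mD := @measurable_discR R.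
rewrite -[RHS](cI_conj mD (inA2_wint hf hg)).
by apply: eq_cI => p _; rewrite conjcM conjcK mulrC.
Qed.

Lemma disc_moment_neq0 (R : realType) (alpha : R) k : -1 < alpha ->
  (moment alpha (discR R) k)%:C != 0 :> R[i].
Proof.
move=> ha; apply/eqP => -[] /eqP; rewrite gt_eqF//.
apply: (@moment_gt0 _ _ _ 1) => //; first by rewrite ltr01 lexx.
  exact: measurable_discR.
by rewrite discRE.
Qed.

(* [|a 1|] times the first moment of [|z| < rho] is at most [2 |A| rho] times that moment. *)
Lemma first_coef_eq0 (R : realType) (h : R[i] -> R[i]) a C q (A d : R) :
  approx 2^-1 h a C q -> 0 < d ->
  (forall z, normc z <= d -> normc (h z) <= A * normc z ^+ 2) -> a 1%N = 0.
Proof.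
move=> hh d0 hA; have a0 : -1 < (0 : R) by [].
apply: (@normc_eq0_le _ _ (2 * `|A|)) => e e0.
(* Besides staying where the estimates hold, [rho <= e] turns [|A| |z|^2] into at most [|A| e |z|],
   comparable with the integrand of the first moment. *)
pose rho := Num.min (Num.min d 2^-1) e.
have r0 : 0 < rho by rewrite !lt_min d0 invr_gt0 e0 ltr0n.
have : rho <= rho by []; rewrite {2}/rho !le_min => /andP[/andP[rd r2] re].
have r01 : 0 <= rho <= 1 by apply/andP; split; lra.
have dD : disco rho `<=` discR R by rewrite discRE; exact: disco_disc.
have md := @measurable_disco R rho.
have hr := approxS r2 hh; have mh := approx_cmeas (ltW r0) hr.
have m0 : 0 < moment 0 (disco rho) 1.
  by apply: (@moment_gt0 _ _ _ rho) => //; rewrite r0; case/andP: r01.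
have := pairing_coef 1 a0 r01 hr.
move=> /(congr1 (@Normc.normc R)).
rewrite [in RHS]Normc.normcM normc_real ger0_norm ?moment_ge0// => E.
rewrite -(ler_pM2r m0) -E.
have [im _] := wint_mono 1 1 a0 md dD.
have iH : (area R).-integrable (disco rho) (EFin \o (fun p =>
    (`|A| * e) * sqmod ((toC p : R[i]) ^+ 1) * bweight 0 p)).
  have := integrable_EFinZ (`|A| * e) md im; congr (_.-integrable _ (EFin \o _)).
  by apply/funext => p; rewrite /mono mulcJ_sqmod /= mulrA.
apply: le_trans (normc_cI md _ iH _) _.
- by apply: cmeasM => //; apply/cmeasJ/cmeasX; exact: cmeas_toC.
- move=> p /(normc_toC_lt (ltW r0))/ltW wr; rewrite Normc.normcM normcJ expr1 sqmodE.
  have wd := le_trans wr rd; have h1 := hA _ wd; have n0 := normc_ge0 (toC p : R[i]).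
  have A1 : A <= `|A| := ler_norm _; have A0 := normr_ge0 A.
  set w := normc (toC p : R[i]) in wr h1 n0 *; have we : w <= e := le_trans wr re.
  have h2 : A * w ^+ 2 <= `|A| * w ^+ 2 by rewrite ler_wpM2r// sqr_ge0.
  apply: (@le_trans _ _ (`|A| * w ^+ 2 * w)); first by rewrite ler_wpM2r// (le_trans h1).
  rewrite -mulrA [_ * w]mulrC mulrA; apply: ler_wpM2r; first by rewrite sqr_ge0.
  by rewrite ler_wpM2l.
- rewrite -[2 * `|A| * e]mulrA -[2 * _ * moment _ _ _]mulrA ler_wpM2l// /moment.
  rewrite le_eqVlt; apply/orP; left; apply/eqP.
  rewrite -RintegralZl//; first by apply: eq_Rintegral => p _; exact/esym/mulrA.
  move: im; congr (_.-integrable _ (EFin \o _)).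
  by apply/funext => p; rewrite /mono mulcJ_sqmod.
Qed.

Lemma coef1_only (R : realType) (f : R[i] -> R[i]) (a : nat -> R[i]) rho C q (w : R[i]) :
  approx rho f a C q -> normc w <= rho -> (forall k, k != 1%N -> a k = 0) -> f w = a 1%N * w.
Proof.
move=> [C0 q01 H] wr a0; apply/eqP; rewrite -subr_eq0; apply/eqP.
have /andP[q0 _] := q01.
apply: (@normc_eq0_geometric _ _ (C * q ^+ 2) q) => //.
  by apply: mulr_ge0 => //; exact: exprn_ge0.
move=> n; have := H n.+2 _ wr; rewrite !big_ord_recl a0// mul0r add0r expr1.
rewrite big1 ?addr0 => [|k _]; last by rewrite a0// mul0r.
by rewrite -mulrA -exprD.
Qed.

Theorem theorem3p2 (R : realType) (alpha : R) (halpha : -1 < alpha)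
    (phi : CC R -> CC R) (hphi : holo_self_map phi) :
  (exists psi : CC R -> CC R, holo_self_map psi /\ adjoint_is_comp alpha phi psi)
  <->
  (exists delta : R[i], `|delta| <= 1 /\
     (forall z : CC R, in_disc z -> phi z = delta * z)).
Proof.
have hX k : inA2 alpha (fun z : CC R => (z : R[i]) ^+ k).
  apply: inA2_bounded => //; first by apply/holo_discP => z _; exact: cderivX.
  by move=> z z1; rewrite normc_X exprn_ile1 ?normc_ge0// ltW.
have self_pow (h : CC R -> CC R) k : holo_self_map h ->
    inA2 alpha (fun z => (h z : R[i]) ^+ k).
  move=> [hh h1]; apply: (inA2_bounded halpha).
    apply/holo_discP => z /((holo_discP h).1 hh)[l hl].
    have [m hm] := cderivX k (h z : R[i]).
    by eexists; apply: (cderiv_comp (f := fun z => z ^+ k) hm hl).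
  move=> z /in_discP /h1 /in_discP h2.
  by rewrite normc_X exprn_ile1 ?normc_ge0// ltW.
have [hph ph1] := hphi; split.
  move=> [psi [hpsi [_ adj]]]; have [hps ps1] := hpsi.
  have adjX j k : binner alpha (fun z => (phi z : R[i]) ^+ j) (fun z => (z : R[i]) ^+ k) =
      binner alpha (fun z => (z : R[i]) ^+ j) (fun z => (psi z : R[i]) ^+ k).
    exact: adj (hX j) (hX k).
  have coefX (h : CC R -> CC R) a k j : holo_self_map h ->
      (forall rho, 0 <= rho < 1 -> exists C q, approx rho (fun z => (h z : R[i]) ^+ k) a C q) ->
      binner alpha (fun z => (z : R[i]) ^+ j) (fun z => (h z : R[i]) ^+ k) =
      conjc (a j * (moment alpha (discR R) j)%:C).
    move=> hh ha; rewrite (binnerC (self_pow _ k hh) (hX j)); congr conjc.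
    exact: (binner_coef j halpha (self_pow _ k hh) ha).
  have idP : holo_self_map (fun z : CC R => z).
    split; last by move=> z hz; exact: hz.
    by apply/holo_discP => z _; exists 1; exact: cderiv_id.
  have M0 k := @disc_moment_neq0 R alpha k halpha.
  have h2 : 0 <= (2^-1 : R) < 1 by apply/andP; split; lra.
  have orth j k : j != k ->
      binner alpha (fun z => (z : R[i]) ^+ j) (fun z => (z : R[i]) ^+ k) = 0.
    move=> jk; rewrite (@coefX id (fun i => (i == k)%:R))//.
      by rewrite (negPf jk) mul0r conjc0.
    move=> rho /andP[_ r1]; exists (2 ^+ k), 2^-1; exact: approx_mono (ltW r1).
  have psi0 : psi 0 = 0.
    have [b Hb] := taylor (self_pow _ 1 hpsi).1.
    have := adjX 0 1%N; rewrite (coefX _ _ _ _ hpsi Hb).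
    have -> : (fun z : CC R => (phi z : R[i]) ^+ 0) = (fun z : CC R => (z : R[i]) ^+ 0) by [].
    rewrite orth// => /esym/eqP; rewrite conjc_eq0 mulf_eq0 (negPf (M0 0)) orbF => /eqP b0.
    have [C [q hb]] := Hb _ h2.
    have h20 : (0 : R) <= 2^-1 by lra.
    by have := approx_at0 h20 hb; rewrite b0 expr1 => <-.
  have [a Ha] := taylor (self_pow _ 1 hphi).1.
  have a0 k : k != 1%N -> a k = 0.
    move=> k1; have := adjX 1%N k.
    rewrite (binner_coef k halpha (self_pow _ 1%N hphi) Ha).
    have [b Hb] := taylor (self_pow _ k hpsi).1.
    have -> : binner alpha (fun z => (z : R[i]) ^+ 1) (fun z => (psi z : R[i]) ^+ k) = 0.
      (* For [k = 0] the power of [psi] is the constant 1, which does not vanish at 0; orthogonality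
         of [z] and 1 is used instead. *)
      have [k0|k0] := eqVneq k 0%N; first by rewrite k0; exact: (@orth 1%N 0%N isT).
      have [C [q hb]] := Hb _ h2.
      have p01 : normc (0 : R[i]) < 1 by rewrite Normc.normc0.
      have [l hl] := (holo_discP psi).1 hps 0 p01.
      have [A [d [A0 d0 HA]]] := expands_lip (fun=> normc_ge0 _) hl.
      rewrite (coefX _ _ _ _ hpsi Hb).
      suff -> : b 1%N = 0 by rewrite mul0r conjc0.
      (* Near 0 one has [|psi z| <= A |z|], and [|psi z| < 1] gives [|psi z|^k <= |psi z|^2] for
         [k >= 2]. The minimum with [1/2] keeps [z] inside the disc. *)
      apply: (@first_coef_eq0 R _ b C q (A ^+ 2) (Num.min d 2^-1) hb).
        by rewrite lt_min d0 invr_gt0 ltr0n.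
      move=> z; rewrite le_min => /andP[zd z2].
      have z1 : normc z < 1 by lra.
      have := HA z; rewrite psi0 !subr0 => /(_ zd) hz.
      have /in_discP s1 := ps1 _ ((in_discP z).2 z1).
      have k2 : (2 <= k)%N by case: k k1 k0 {Hb hb} => [|[|k]].
      rewrite normc_X -exprMn -(subnK k2) exprD.
      apply: (@le_trans _ _ (normc (psi z : R[i]) ^+ 2)).
        by rewrite ler_piMl ?exprn_ge0 ?normc_ge0// exprn_ile1 ?normc_ge0// ltW.
      by rewrite lerXn2r ?nnegrE ?mulr_ge0 ?normc_ge0// ltW.
    by move=> /eqP; rewrite mulf_eq0 (negPf (M0 k)) orbF => /eqP.
  have phiE (z : R[i]) : normc z < 1 -> phi z = a 1%N * z.
    move=> z1; have r01 : 0 <= normc z < 1 by rewrite normc_ge0.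
    have [C [q h]] := Ha _ r01.
    by rewrite -(coef1_only h (lexx _) a0) expr1.
  exists (a 1%N); split; last by move=> z /in_discP; exact: phiE.
  rewrite normcE -[1]/(1%:C) lecR leNgt; apply/negP => a1.
  (* If the slope had modulus above 1, this point of the disc would be sent to modulus exactly 1. *)
  pose x := (normc (a 1%N))^-1.
  have x0 : 0 < x by rewrite invr_gt0 (lt_trans ltr01).
  have nx : normc (x%:C : R[i]) = x by rewrite normc_real gtr0_norm.
  have x1 : normc (x%:C : R[i]) < 1 by rewrite nx invf_lt1// (lt_trans ltr01).
  have /in_discP := ph1 _ ((in_discP _).2 x1).
  rewrite phiE// Normc.normcM nx mulfV ?ltxx// gt_eqF// (lt_trans ltr01)//.
move=> [delta [d1 phiE]].
have {}d1 : normc delta <= 1 by move: d1; rewrite normcE -[1]/(1%:C) lecR.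
have d1' : normc (conjc delta) <= 1 by rewrite normcJ.
exists (fun z : CC R => conjc delta * (z : R[i])); split.
  split.
    apply/holo_discP => z _; eexists.
    exact: cderivM (cderiv_cst (conjc delta) z) (cderiv_id z).
  move=> z /in_discP z1; apply/in_discP; rewrite Normc.normcM.
  by apply: le_lt_trans z1; rewrite ler_piMl ?normc_ge0.
split; first by move=> g hg; exact: (inA2_dilate halpha d1' hg).
move=> f g hf hg; rewrite -[RHS](binner_dilate halpha d1 hf hg).
(* [phi] is linear on the disc only, and the inner product sees no other values. *)
apply: (@eq_cI R alpha (discR R)) => p; rewrite discRE => /(normc_toC_lt ler01) hp.
by congr (_ * _); rewrite /= phiE//; exact/in_discP.
Qed.
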